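(* Let $G\subseteq\Omega$ be a subdomain and assume $u\in W^{r+\delta,p}(G)$ $(\delta>0)$ and that there exists a multi-index $\gamma$ with $|\gamma|=r$ such that $\|D^{\gamma}u\|_{0,p,G}>0$ and $D^{\gamma}v_h=0$ for any $v_h\in V_h$. Then the following lower bounds of the approximation error hold when the family $\{\mathcal{T}_h\}$ of partitions is regular: $$\inf_{v_h\in V_h}\Big(\sum_{K\in\mathcal{T}_h^G}h_K^{p(j-r)}\|u-v_h\|_{j,p,K}^p\Big)^{1/p}\ \ge\ C_5,\qquad 0\le j\le r,$$ and $$\inf_{v_h\in V_h}\Big(\sum_{K\in\mathcal{T}_h^G}h_K^{p\left((j-r)+n\left(\frac1p-\frac1q\right)\right)}\|u-v_h\|_{j,q,K}^p\Big)^{1/p}\ \ge\ C_6,\qquad 0\le j\le r,$$ where $1\le p<\infty$, $1\le q\le\infty$ (such that $W^{r+\delta,p}(G)$ can be imbedded into $W^{j,q}(G)$), and $C_5$ and $C_6$ are positive constants independent of the mesh size $h_G$, but dependent on $u$.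
   Context: $\Omega\subset\mathbb{R}^n$ ($n\ge1$) is a bounded polytopic domain with Lipschitz continuous boundary. $W^{s,p}(G)$ denotes the usual Sobolev space with norm $\|\cdot\|_{s,p,G}$; $D^\alpha$ is the partial derivative of multi-index $\alpha$ and $|\alpha|=\sum_i\alpha_i$. $\mathcal{T}_h$ is a face-to-face partition of $\Omega$ into elements $K$ (triangles, rectangles, tetrahedra, bricks, etc.), so $\bar\Omega=\bigcup_{K\in\mathcal{T}_h}K$; $h_K=\mathrm{diam}\,K$ and $h=\max_{K\in\mathcal{T}_h}h_K$. For $G\subseteq\Omega$, $\mathcal{T}_h^G=\{K\in\mathcal{T}_h: K\subset G\}$ and $h_G=\max_{K\in\mathcal{T}_h^G}h_K$. A family $\{\mathcal{T}_h\}$ is regular if there is $\sigma>0$ with $h_K/\tau_K<\sigma$ for all $K\in\mathcal{T}_h$, where $\tau_K$ is the maximum diameter of an inscribed ball in $K$. $V_h$ is the finite element space of piecewise polynomial functions of degree less than $r$ ($r\ge1$ an integer) built on $\mathcal{T}_h$; derivatives of $v_h\in V_h$ are taken element by element. $\|\cdot\|_{j,q,K}$ is the $W^{j,q}(K)$ norm.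
   Formalization: The bounds are stated for partitions whose elements in T_h^G cover G (always so for G = Ω), or with h < h0 for some h0 > 0 independent of the mesh; for coarse partitions not aligned with G, T_h^G may be empty and the bounds fail. K ⊂ G is read as: the interior of K lies in G. *)

(* Defs.v *)
From HB Require Import structures.
From mathcomp Require Import all_boot all_order all_algebra.
From mathcomp Require Import all_classical all_reals all_analysis.
Set Implicit Arguments.
Unset Strict Implicit.
Unset Printing Implicit Defensive.
Import Order.TTheory GRing.Theory Num.Theory.
Import numFieldNormedType.Exports.
Local Open Scope classical_set_scope.
Local Open Scope ring_scope.

(* Coordinate (= Borel) sigma-algebra and Lebesgue measure on R^n, the latter
   as the image of the product measure on R x R^(n-1). *)
Definition rV_display : measure_display.
Proof. exact: default_measure_display. Qed.

Section measurable_rV.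
Context {R : realType} {n : nat}.

Definition rV_measurable : set_system 'rV[R]_n :=
  <<s [set (fun x : 'rV[R]_n => x 0 i) @^-1` A | i in [set: 'I_n]
        & A in @measurable _ (measurableTypeR R)] >>.
Let m0 : rV_measurable set0. Proof. exact: sigma_algebra0. Qed.
Let mC A : rV_measurable A -> rV_measurable (~` A).
Proof. exact: sigma_algebraC. Qed.
Let mU (F : _^nat) : (forall i, rV_measurable (F i)) -> rV_measurable (\bigcup_i F i).
Proof. exact: sigma_algebra_bigcup. Qed.
HB.instance Definition _ := @isMeasurable.Build rV_display 'rV[R]_n rV_measurable m0 mC mU.

Lemma measurable_coord (i : 'I_n) :
  measurable_fun setT (fun x : 'rV[R]_n => x 0 i : measurableTypeR R).
Proof.
move=> _ A mA; rewrite setTI; apply: sub_sigma_algebra.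
by exists i => //; exists A.
Qed.

Lemma measurable_rV d (T : measurableType d) (f : T -> 'rV[R]_n) :
  (forall i, measurable_fun setT (fun x => f x 0 i : measurableTypeR R)) ->
  measurable_fun setT f.
Proof.
move=> mf; apply: measurability; first by [].
by move=> _ [_ [i _ [A mA <-]] <-]; exact: mf.
Qed.

End measurable_rV.

Section rV_cons.
Context {R : realType} {n : nat}.

Definition rV_cons (x : measurableTypeR R * 'rV[R]_n) : 'rV[R]_n.+1 :=
  \row_i (if unlift ord0 i is Some j then x.2 0 j else x.1).

Definition rV_uncons (v : 'rV[R]_n.+1) : measurableTypeR R * 'rV[R]_n :=
  (v 0 ord0, \row_j v 0 (lift ord0 j)).

Lemma rV_uncons_cons : cancel rV_uncons rV_cons.
Proof.
move=> v; apply/rowP => i; rewrite mxE.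
by case: unliftP => [j ->|->] //=; rewrite mxE.
Qed.

Lemma rV_cons_uncons : cancel rV_cons rV_uncons.
Proof.
move=> [x v]; rewrite /rV_uncons mxE unlift_none; congr pair.
by apply/rowP => i; rewrite !mxE liftK.
Qed.

Lemma measurable_rV_cons : measurable_fun setT rV_cons.
Proof.
apply: measurable_rV => i; case: (unliftP ord0 i) => [j ->|->].
- under eq_fun do rewrite mxE liftK.
  exact: (measurableT_comp (measurable_coord j) measurable_snd).
- by under eq_fun do rewrite mxE unlift_none; exact: measurable_fst.
Qed.

Lemma measurable_rV_uncons : measurable_fun setT rV_uncons.
Proof.
apply/measurable_fun_pairP; split; first exact: measurable_coord.
apply: measurable_rV => j /=.
by under eq_fun do rewrite mxE; exact: measurable_coord.
Qed.

End rV_cons.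

Section lebesgue_rV_step.
Context {R : realType} {n : nat}.
Variable mu : {sigma_finite_measure set 'rV[R]_n -> \bar R}.

Definition lebesgue_rV_step : set 'rV[R]_n.+1 -> \bar R :=
  fun A => (@lebesgue_measure R \x mu)%E (rV_cons @^-1` A).

Let preimage_cons A : measurable A -> measurable (@rV_cons R n @^-1` A).
Proof.
by move=> mA; rewrite -[X in measurable X]setTI; exact: measurable_rV_cons.
Qed.

Let step0 : lebesgue_rV_step set0 = 0%E.
Proof. by rewrite /lebesgue_rV_step preimage_set0 measure0. Qed.

Let step_ge0 A : (0 <= lebesgue_rV_step A)%E.
Proof. exact: measure_ge0. Qed.

Let step_sigma_additive : semi_sigma_additive lebesgue_rV_step.
Proof.
move=> F mF tF mUF; rewrite /lebesgue_rV_step preimage_bigcup.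
apply: measure_semi_sigma_additive.
- by move=> k; exact: preimage_cons.
- apply/trivIsetP => /= i j _ _ ij; rewrite -preimage_setI.
  by move/trivIsetP : tF => /(_ _ _ _ _ ij) ->//; rewrite preimage_set0.
- by rewrite -preimage_bigcup; exact: preimage_cons.
Qed.

HB.instance Definition _ := isMeasure.Build _ _ _
  lebesgue_rV_step step0 step_ge0 step_sigma_additive.

Let sigma_finite_step : sigma_finite setT lebesgue_rV_step.
Proof.
have /sigma_finiteP[F [TF ndF Foo]] := sigma_finiteT (@lebesgue_measure R).
have /sigma_finiteP[G [TG ndG Goo]] := sigma_finiteT mu.
have preimage_uncons k :
    rV_cons @^-1` (rV_uncons @^-1` (F k `*` G k)) = F k `*` G k.
  by rewrite -comp_preimage; have -> : rV_uncons \o rV_cons = @id (R * 'rV[R]_n)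
    by apply/funext => x; exact: rV_cons_uncons.
exists (fun k => rV_uncons @^-1` (F k `*` G k)).
  apply/esym; rewrite -subTset => v _.
  have : [set: measurableTypeR R] (rV_uncons v).1 by [].
  have : [set: 'rV[R]_n] (rV_uncons v).2 by [].
  rewrite TF TG => -[k _ Gk] [l _ Fl]; exists (maxn l k) => //; split.
  - by move: Fl; exact/subsetPset/ndF/leq_maxl.
  - by move: Gk; exact/subsetPset/ndG/leq_maxr.
move=> k; have [mFk Fk] := Foo k; have [mGk Gk] := Goo k; split.
  rewrite -[X in measurable X]setTI.
  by apply: measurable_rV_uncons => //; exact: measurableX.
rewrite /lebesgue_rV_step preimage_uncons product_measure1E//.
by rewrite lte_mul_pinfty// ge0_fin_numE.
Qed.

HB.instance Definition _ :=
  Measure_isSigmaFinite.Build _ _ _ lebesgue_rV_step sigma_finite_step.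
End lebesgue_rV_step.

Fixpoint lebesgue_rV (R : realType) (n : nat) :
    {sigma_finite_measure set 'rV[R]_n -> \bar R} :=
  match n with
  | 0%N => dirac (0 : 'rV[R]_0)
  | m.+1 => lebesgue_rV_step (lebesgue_rV R m)
  end.

Section geometry.
Context {R : realType} {n : nat}.
Implicit Types (x y : 'rV[R]_n) (K F G Omega : set 'rV[R]_n).
Implicit Types T : seq (set 'rV[R]_n).

(* The norm `|x| of the library on 'rV[R]_n is the sup norm. *)
Definition dot x y : R := \sum_i x 0 i * y 0 i.
Definition enorm x : R := Num.sqrt (dot x x).
Definition eball x (e : R) : set 'rV[R]_n := [set y | enorm (y - x) < e].

Definition diam K : R := sup [set enorm (x - y) | x in K & y in K].
Definition inscribed_diam K : R :=
  sup [set 2 * e | e in [set e : R | 0 < e /\ exists x, eball x e `<=` K]].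

(* convex hull of the rows of P *)
Definition convex_hull m (P : 'M[R]_(m, n)) : set 'rV[R]_n :=
  [set w *m P | w in
    [set w : 'rV[R]_m | (forall i, 0 <= w 0 i) /\ \sum_i w 0 i = 1]].
Definition polytope K := exists m (P : 'M[R]_(m, n)), K = convex_hull P.

(* exposed faces; for polytopes these are all the faces, K itself (a = 0, b = 0)
   and the empty face (a = 0, b = 1) included *)
Definition is_face F K := exists (a : 'rV[R]_n) (b : R),
  (forall x, K x -> dot a x <= b) /\ F = K `&` [set x | dot a x = b].

Definition is_domain G := [/\ open G, connected G & G !=set0].

(* Around each boundary point, Omega is the strict epigraph, in the direction of
   a unit vector e, of a Lipschitz function of the coordinates orthogonal to e;
   such a function is given by phi : R^n -> R invariant along e. *)
Definition lipschitz_boundary Omega := forall x, closure Omega x -> ~ Omega x ->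
  exists (e : 'rV[R]_n) (phi : 'rV[R]_n -> R) (L eps : R),
  [/\ enorm e = 1, 0 < eps,
      forall y z, `|phi y - phi z| <= L * enorm (y - z),
      forall y t, phi (y + t *: e) = phi y
    & forall y, eball x eps y -> (Omega y <-> phi y < dot e y)].

Definition polytopic_lipschitz_domain Omega :=
  [/\ is_domain Omega, bounded_set Omega,
      exists2 S : seq (set 'rV[R]_n), (forall K, K \in S -> polytope K)
        & closure Omega = \bigcup_(K in [set` S]) K
    & lipschitz_boundary Omega].

Record is_mesh Omega T : Prop := {
  mesh_uniq : uniq T;
  mesh_polytope : forall K, K \in T -> polytope K /\ K° !=set0;
  mesh_cover : closure Omega = \bigcup_(K in [set` T]) K;
  mesh_disjoint : forall K K', K \in T -> K' \in T -> K <> K' ->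
    K° `&` K'° = set0;
  mesh_face_to_face : forall K K', K \in T -> K' \in T -> K <> K' ->
    is_face (K `&` K') K /\ is_face (K `&` K') K' }.

Definition mesh_size T : R := \big[Order.max/0]_(K <- T) diam K.

(* The elements are closed and G is open: an element counts as contained in G
   when its interior is, so that every element is in submesh T Omega. *)
Definition submesh T G : seq (set 'rV[R]_n) := [seq K <- T | `[< K° `<=` G >]].

Definition resolves T G := G `<=` \bigcup_(K in [set` submesh T G]) K.

Definition regular_family (I : Type) (T : I -> seq (set 'rV[R]_n)) :=
  exists2 sigma : R, 0 < sigma &
    forall i K, K \in T i -> diam K / inscribed_diam K < sigma.

End geometry.

Section derivatives.
Context {R : realType} {n : nat}.
Implicit Types (f phi v w g : 'rV[R]_n -> R) (G : set 'rV[R]_n).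
Implicit Types alpha : 'I_n -> nat.

Definition midx_order alpha : nat := \sum_i alpha i.

Definition partial (i : 'I_n) f : 'rV[R]_n -> R :=
  fun x => 'D_(delta_mx 0 i) f x.
Definition mpartial alpha f : 'rV[R]_n -> R :=
  foldr (fun i => iter (alpha i) (partial i)) f (enum 'I_n).

Fixpoint Ck (k : nat) f : Prop :=
  continuous f /\
  if k is k'.+1 then
    forall i, (forall x, derivable f x (delta_mx 0 i)) /\ Ck k' (partial i f)
  else True.

Definition test_function G phi :=
  (forall k, Ck k phi) /\
  exists C, [/\ compact C, C `<=` G & forall x, ~ C x -> phi x = 0].

Definition locally_Lebesgue_integrable G f :=
  measurable_fun G f /\
  forall C, compact C -> C `<=` G ->
    (\int[lebesgue_rV R n]_(x in C) `|f x|%:E < +oo)%E.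

Definition is_weak_derivative G alpha w g :=
  [/\ locally_Lebesgue_integrable G w, locally_Lebesgue_integrable G g
    & forall phi, test_function G phi ->
      (\int[lebesgue_rV R n]_(x in G) (w x * mpartial alpha phi x)%:E =
       ((-1) ^+ midx_order alpha)%:E *
       \int[lebesgue_rV R n]_(x in G) (g x * phi x)%:E)%E].

(* some representative of D^alpha w on G, and 0 if there is none *)
Definition weakD G alpha w : 'rV[R]_n -> R :=
  xget (cst 0) [set g | is_weak_derivative G alpha w g].

End derivatives.

Section sobolev.
Context {R : realType} {n : nat}.
Implicit Types (f v w : 'rV[R]_n -> R) (G : set 'rV[R]_n) (p : R) (q : \bar R).

Definition Lp_norm G q f : \bar R := 'N[lebesgue_rV R n]_q[(EFin \o f) \_ G].

Definition in_sobolev (m : nat) q G w := forall alpha : 'I_n -> nat,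
  (midx_order alpha <= m)%N ->
  (exists g, is_weak_derivative G alpha w g) /\
  (Lp_norm G q (weakD G alpha w) < +oo)%E.

Definition sobolev_norm (m : nat) q G w : \bar R :=
  match q with
  | p%:E => ((\sum_(alpha : {ffun 'I_n -> 'I_m.+1} |
                    (midx_order (fun i => alpha i) <= m)%N)
               Lp_norm G q (weakD G (fun i => alpha i) w) `^ p) `^ p^-1)%E
  | _ => (\big[maxe/0]_(alpha : {ffun 'I_n -> 'I_m.+1} |
                    (midx_order (fun i => alpha i) <= m)%N)
               Lp_norm G q (weakD G (fun i => alpha i) w))%E
  end.

(* p-th power of the Gagliardo seminorm of order theta, 0 < theta < 1 *)
Definition gagliardo (theta : R) p G f : \bar R :=
  (\int[lebesgue_rV R n]_(x in G) \int[lebesgue_rV R n]_(y in G)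
     (`|f x - f y| `^ p * enorm (x - y) `^ (- (n%:R + theta * p)))%:E)%E.

(* W^{s,p}(G) for real s >= 0, 1 <= p < oo: for s = m + theta with m natural and
   0 < theta < 1, the Sobolev-Slobodeckij space *)
Definition frac_seminorm (s : R) p G w : \bar R :=
  let m := Num.truncn s in
  let theta := s - m%:R in
  if theta == 0 then 0%E else
  (\sum_(alpha : {ffun 'I_n -> 'I_m.+1} | midx_order (fun i => alpha i) == m)
    gagliardo theta p G (weakD G (fun i => alpha i) w))%E.

Definition in_frac_sobolev (s : R) p G w :=
  in_sobolev (Num.truncn s) p%:E G w /\ (frac_seminorm s p G w < +oo)%E.

Definition frac_sobolev_norm (s : R) p G w : \bar R :=
  ((sobolev_norm (Num.truncn s) p%:E G w `^ p + frac_seminorm s p G w)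
     `^ p^-1)%E.

(* continuous embedding of W^{s,p}(G) into W^{j,q}(G) *)
Definition sobolev_embeds (s : R) p (j : nat) q G := exists C : R, forall w,
  in_frac_sobolev s p G w ->
  in_sobolev j q G w /\
  (sobolev_norm j q G w <= C%:E * frac_sobolev_norm s p G w)%E.

End sobolev.

Section finite_elements.
Context {R : realType} {n : nat}.
Implicit Types (u v : 'rV[R]_n -> R) (G : set 'rV[R]_n).
Implicit Types (T : seq (set 'rV[R]_n)) (V : set ('rV[R]_n -> R)).

(* polynomial functions of degree < r in each variable; these include the
   polynomials of total degree < r *)
Definition polynomial_lt (r : nat) v :=
  exists c : {ffun 'I_n -> 'I_r} -> R,
    forall x, v x = \sum_a c a * \prod_i x 0 i ^+ a i.

(* v in V stands for the family of its restrictions to the interiors of the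
   elements; its values on the skeleton of the mesh play no role. *)
Definition piecewise_polynomial (r : nat) T v := forall K, K \in T ->
  exists2 P, polynomial_lt r P & forall x, K° x -> v x = P x.

Definition fe_space (r : nat) T V :=
  [/\ V (cst 0),
      forall (a : R) v w, V v -> V w -> V (fun x => a * v x + w x)
    & forall v, V v -> piecewise_polynomial r T v].

Definition elementwise_derivative_zero T (gamma : 'I_n -> nat) v :=
  forall K, K \in T -> forall x, K° x -> mpartial gamma v x = 0.

(* inf over V of
     (sum_(K in T^G) h_K ^ e * ||u - v||_{j,q,K} ^ p) ^ (1/p) *)
Definition approximation_error (p e : R) (j : nat) (q : \bar R) G T V u
    : \bar R :=
  ereal_inf [set ((\sum_(K <- submesh T G)
      (diam K `^ e)%:E * sobolev_norm j q K° (u \- v)%R `^ p) `^ p^-1)%E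
    | v in V].

End finite_elements.

(* Main.v *)
Require Import Defs.
From HB Require Import structures.
From mathcomp Require Import all_boot all_order all_algebra.
From mathcomp Require Import all_classical all_reals all_analysis.
From mathcomp Require Import measurable_realfun ess_sup_inf.
From mathcomp Require Import zify ring lra.
Set Implicit Arguments.
Unset Strict Implicit.
Unset Printing Implicit Defensive.
Import Order.TTheory GRing.Theory Num.Theory.
Import numFieldNormedType.Exports.
Local Open Scope classical_set_scope.
Local Open Scope ring_scope.

(* Let v be discrete, phi a bump function supported in an element K, and write
   gamma = alpha + beta with |alpha| = j.  Since D^gamma v = 0 on K, integration
   by parts gives, up to sign,
     int_K (D^gamma u) phi = int_K D^alpha (u - v) D^beta phi,
   where D^beta phi is O(h_K^(j-r)) when phi lives on a cube of size ~ h_K.  So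
   the moment of D^gamma u on the left is controlled by h_K^(j-r) times the L1
   norm of D^alpha (u - v) on K.

   Density of the continuous functions in L1 provides a continuous f close to
   D^gamma u with |f| >= t on a compact set C of positive measure, and f has
   constant sign at a uniform scale eta.  For each K, a maximal separated subset
   of the intersection of C and K, moved inside K by convexity and regularity,
   yields disjoint cubes of size ~ min(h_K, eta) whose total measure is at least a
   fixed fraction of that of the intersection; summing the moments of the bumps on
   these cubes over all K gives
     eps <= c * sum_K h_K^(j-r) ||D^alpha (u - v)||_{1,K}.
   Hoelder's inequality on K, of measure ~ h_K^n, and Young's inequality with a
   parameter (as sum_K h_K^n is bounded) turn this into both lower bounds. *)

(** * Lebesgue measure and the topology of R^n *)

Section rV_topology.
Context {R : realType} {n : nat}.
Implicit Types (x y : 'rV[R]_n) (A C G : set 'rV[R]_n).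

Lemma ball_rVP x (r : R) y : 0 < r ->
  ball x r y <-> forall i, `|x 0 i - y 0 i| < r.
Proof.
move=> r0; split=> [[_ H] i|H]; first exact: H.
by split=> // i j; rewrite ord1; exact: H.
Qed.

Lemma norm_rVP x (r : R) : 0 <= r -> `|x| <= r <-> forall i, `|x 0 i| <= r.
Proof.
move=> r0; rewrite {1}/Num.norm/= mx_normrE; split.
  move=> /bigmax_leP[_ H] i; exact: (H (0, i)).
by move=> H; apply/bigmax_leP; split=> // -[i j] _ /=; rewrite ord1.
Qed.

Lemma ler_norm_coord x i : `|x 0 i| <= `|x|.
Proof. by move: i; apply/norm_rVP. Qed.

Lemma measurable_ball_rV x (r : R) : measurable (ball x r : set 'rV[R]_n).
Proof.
have [r0|r0] := ltP 0 r; last first.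
  rewrite (_ : ball _ _ = set0) //; apply/seteqP; split => y //= [r1 _].
  by rewrite ltNge r0 in r1.
rewrite (_ : ball x r =
    \big[setI/setT]_(i < n) ((fun y : 'rV[R]_n => y 0 i) @^-1` ball (x 0 i) r)).
  apply: bigsetI_measurable => i _; rewrite -[X in measurable X]setTI.
  by apply: (measurable_coord i) => //; exact: measurable_ball.
rewrite -bigcap_seq; apply/seteqP; split => y /=.
  by move=> /(ball_rVP _ _ r0) H i _; exact: H.
by move=> H; apply/(ball_rVP _ _ r0) => i; apply: H => /=; rewrite mem_index_enum.
Qed.

Lemma open_measurable_rV A : open A -> measurable A.
Proof.
move=> oA.
pose B (a : 'rV[rat]_n * nat) :=
  ball (\row_i (ratr (a.1 0 i)) : 'rV[R]_n) (a.2.+1%:R^-1).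
rewrite (_ : A = \bigcup_a (if `[< B a `<=` A >] then B a else set0)).
  apply: countable_bigcupT_measurable => [|a]; first exact: countableP.
  by case: ifP => // _; exact: measurable_ball_rV.
apply/seteqP; split=> [x Ax|x [a _]]; last first.
  by case: ifPn => // /asboolP; exact.
have /nbhs_ballP[e /= e0 eA] := open_nbhs_nbhs (conj oA Ax).
have [k ke] : exists k : nat, k.+1%:R^-1 < e / 2.
  by have [k] := ltr_add_invr (divr_gt0 e0 (ltr0Sn R 1)); rewrite add0r; exists k.
have ex i : exists q : rat, `|x 0 i - ratr q| < k.+1%:R^-1.
  have : x 0 i - k.+1%:R^-1 < x 0 i + k.+1%:R^-1.
    by rewrite ltrD2l gtrN// invr_gt0.
  move=> /rat_in_itvoo[q]; rewrite in_itv/= => /andP[q1 q2]; exists q.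
  by rewrite ltr_distlC q1 q2.
pose a : 'rV[rat]_n := \row_i (projT1 (cid (ex i))).
have ax : B (a, k) x.
  apply/ball_rVP; rewrite ?invr_gt0// => i /=.
  by rewrite !mxE distrC; case: cid.
exists (a, k) => //; rewrite asboolT// => y By.
apply: eA; rewrite [e]splitr.
apply: ball_triangle (le_ball (ltW ke) By).
exact/ball_sym/(le_ball (ltW ke) ax).
Qed.

Lemma closed_measurable_rV A : closed A -> measurable A.
Proof.
move=> cA; rewrite -[A]setCK; apply: measurableC; apply: open_measurable_rV.
exact: closed_openC.
Qed.

Lemma compact_measurable_rV A : compact A -> measurable A.
Proof.
move=> cA; apply: closed_measurable_rV; exact: compact_closed.
Qed.

Lemma continuous_measurable_rV (f : 'rV[R]_n -> R) : continuous f ->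
  measurable_fun setT f.
Proof.
move=> cf; apply: (measurability _ (RGenOpens.measurableE R)) => //.
move=> _ [_ [a [b ->]] <-]; rewrite setTI; apply: open_measurable_rV.
by move/continuousP : cf; apply; exact: interval_open.
Qed.

End rV_topology.

Section lebesgue_rV_ball.
Context {R : realType}.

Lemma lebesgue_rV_ball n (x : 'rV[R]_n) (r : R) : 0 < r ->
  lebesgue_rV R n (ball x r) = ((r *+ 2) ^+ n)%:E.
Proof.
elim: n x => [|n IH] x r0.
  by rewrite /= expr0 diracE mem_set//; apply/ball_rVP => // -[].
rewrite /= /lebesgue_rV_step.
have -> : rV_cons @^-1` ball x r =
    ball (x 0 ord0) r `*` ball (\row_j x 0 (lift ord0 j)) r.
  apply/seteqP; split => [[t y] /= /(ball_rVP _ _ r0) H|[t y] [/= H1 /(ball_rVP _ _ r0) H2]].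
    split; first by have := H ord0; rewrite mxE unlift_none.
    by apply/ball_rVP => // j; have := H (lift ord0 j); rewrite !mxE liftK.
  apply/ball_rVP => // i; rewrite mxE; case: unliftP => [j ->|-> //].
  by have := H2 j; rewrite mxE.
rewrite product_measure1E//=; [|exact: measurable_ball|exact: measurable_ball_rV].
by rewrite IH// lebesgue_measure_ball ?ltW// -EFinM exprS.
Qed.

Lemma lebesgue_rV_bounded n (A : set 'rV[R]_n) : measurable A ->
  bounded_set A -> (lebesgue_rV R n A < +oo)%E.
Proof.
move=> mA [M [_ HM]].
have M0 : 0 < `|M| + 2 by rewrite ltr_wpDl.
apply: (@le_lt_trans _ _ (lebesgue_rV R n (ball 0 (`|M| + 2)))); last first.
  by rewrite lebesgue_rV_ball// ltry.
apply: le_measure; rewrite ?inE//; first exact: measurable_ball_rV.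
move=> x /(HM (`|M| + 1)) => /(_ _)/wrap[]; first by rewrite ltr_pwDr// ler_norm.
move=> xM; rewrite -ball_normE/= sub0r normrN (le_lt_trans xM)//.
by rewrite ltrD2l ltr1n.
Qed.

Lemma lebesgue_rV_compact n (A : set 'rV[R]_n) : compact A ->
  (lebesgue_rV R n A < +oo)%E.
Proof.
move=> cA; apply: lebesgue_rV_bounded; first exact: compact_measurable_rV.
exact: compact_bounded.
Qed.

End lebesgue_rV_ball.

(** * Smooth functions of one variable and the standard bump *)

Section smooth_real.
Context {R : realType}.
Implicit Types (f g : R -> R) (k : nat).

Fixpoint nsmooth k f : Prop :=
  (forall x, derivable f x 1) /\ if k is k'.+1 then nsmooth k' (derive1 f) else True.

Definition smooth f := forall k, nsmooth k f.

Lemma nsmooth_derivable k f x : nsmooth k f -> derivable f x 1.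
Proof. by case: k => [|k] []. Qed.

Lemma nsmoothW k f : nsmooth k.+1 f -> nsmooth k f.
Proof.
elim: k f => [|k IH] f; first by move=> [df _]; split.
by move=> [df H]; split => //; exact: IH.
Qed.

Lemma nsmoothS k f f' : (forall x, derivable f x 1) ->
  (forall x, derive1 f x = f' x) -> (forall m, (m < k)%N -> nsmooth m f') ->
  nsmooth k f.
Proof.
move=> df ff' sf'; case: k sf' => [|k] sf'; first by [].
split; first by [].
by rewrite (_ : derive1 f = f'); [exact: sf'|exact/funext].
Qed.

Lemma nsmooth_le k m f : (m <= k)%N -> nsmooth k f -> nsmooth m f.
Proof.
elim: k => [|k IH]; first by rewrite leqn0 => /eqP ->.
by rewrite leq_eqVlt => /orP[/eqP-> //|/IH H /nsmoothW].
Qed.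

Lemma nsmoothD k f g : nsmooth k f -> nsmooth k g -> nsmooth k (f \+ g).
Proof.
elim: k f g => [|k IH] f g sf sg.
  apply: nsmoothS; [|by move=> x; reflexivity|by []] => x.
  by apply: derivableD; [exact: nsmooth_derivable sf|exact: nsmooth_derivable sg].
have [df sf'] := sf; have [dg sg'] := sg.
apply: (@nsmoothS _ _ (derive1 f \+ derive1 g)) => [x|x|m mk].
- exact: derivableD.
- by rewrite /= !derive1E deriveD.
- by apply: (@nsmooth_le k) => //; exact: IH.
Qed.

Lemma nsmoothM k f g : nsmooth k f -> nsmooth k g -> nsmooth k (f \* g).
Proof.
elim: k f g => [|k IH] f g sf sg.
  apply: nsmoothS; [|by move=> x; reflexivity|by []] => x.
  by apply: derivableM; [exact: nsmooth_derivable sf|exact: nsmooth_derivable sg].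
have [df sf'] := sf; have [dg sg'] := sg.
apply: (@nsmoothS _ _ ((f \* derive1 g) \+ (g \* derive1 f))) => [x|x|m mk].
- exact: derivableM.
- by rewrite /= !derive1E deriveM.
- apply: (@nsmooth_le k) => //; apply: nsmoothD; apply: IH => //.
  + exact: nsmoothW sf.
  + exact: nsmoothW sg.
Qed.

Lemma nsmooth_cst k (a : R) : nsmooth k (fun _ : R => a).
Proof.
elim: k a => [|k IH] a; apply: (@nsmoothS _ _ (fun _ => 0)) => [x|x|m mk].
- exact: derivable_cst.
- by rewrite derive1_cst.
- by [].
- exact: derivable_cst.
- by rewrite derive1_cst.
- exact: nsmooth_le (IH 0).
Qed.

Lemma nsmooth_id k : nsmooth k (fun x : R => x).
Proof.
apply: (@nsmoothS _ _ (fun _ => 1)) => [x|x|m mk].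
- exact: derivable_id.
- by rewrite derive1_id.
- exact: nsmooth_cst.
Qed.

Lemma nsmoothX k m : nsmooth k (fun t : R => t ^+ m).
Proof.
elim: m => [|m IH]; first exact: nsmooth_cst.
rewrite (_ : (fun t => _) = (fun t : R => t) \* (fun t : R => t ^+ m)).
  by apply: nsmoothM => //; exact: nsmooth_id.
by apply/funext => t; rewrite exprS.
Qed.

Lemma is_derive_affine (a b x : R) : is_derive x 1 (fun t => a * t + b) a.
Proof.
have h : is_derive x (1 : R) (a \*: (id : R -> R) + cst b) (a *: 1 + 0).
  by apply: is_deriveD.
by apply: is_derive_eq; rewrite addr0 /GRing.scale/= mulr1.
Qed.

Lemma derivable_affine f (a b x : R) : (forall x, derivable f x 1) ->
  derivable (fun t => f (a * t + b)) x 1.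
Proof.
move=> df; have := is_derive_affine a b x => h.
have h2 : is_derive (a * x + b) 1 f (derive1 f (a * x + b)).
  by rewrite derive1E; exact: derivableP.
by have [] := @is_derive1_comp _ f (fun t => a * t + b) x _ _ h2 h.
Qed.

Lemma derive1_affine f (a b : R) : (forall x, derivable f x 1) ->
  derive1 (fun t => f (a * t + b)) = (fun t => a * derive1 f (a * t + b)).
Proof.
move=> df; apply/funext => x; have := is_derive_affine a b x => h.
have h2 : is_derive (a * x + b) 1 f (derive1 f (a * x + b)).
  by rewrite derive1E; exact: derivableP.
have h3 := @is_derive1_comp _ f (fun t => a * t + b) x _ _ h2 h.
by rewrite derive1E mulrC; exact: (@derive_val _ _ _ _ _ _ _ h3).
Qed.

Lemma nsmooth_affine k f (a b : R) : nsmooth k f ->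
  nsmooth k (fun t => f (a * t + b)).
Proof.
elim: k f => [|k IH] f [df sf];
    apply: (@nsmoothS _ _ (fun t => a * derive1 f (a * t + b))) => [x|x|m mk].
- exact: derivable_affine.
- by rewrite derive1_affine.
- by [].
- exact: derivable_affine.
- by rewrite derive1_affine.
- apply: (@nsmooth_le k) => //; apply: (@nsmoothM k (fun=> a)); last exact: IH.
  exact: nsmooth_cst.
Qed.

Lemma smooth_derivable f x : smooth f -> derivable f x 1.
Proof. by move=> /(_ 0%N); exact: nsmooth_derivable. Qed.

Lemma smooth_derive1 f : smooth f -> smooth (derive1 f).
Proof. by move=> sf k; have [] := sf k.+1. Qed.

Lemma smooth_derive1n f m : smooth f -> smooth (derive1n m f).
Proof.
by elim: m f => [//|m IH] f sf; rewrite derive1nS; apply/smooth_derive1/IH.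
Qed.

Lemma smooth_continuous f : smooth f -> continuous f.
Proof.
by move=> sf x; apply/differentiable_continuous/derivable1_diffP/smooth_derivable.
Qed.

Lemma derive1n_affine f (a b : R) m : smooth f ->
  derive1n m (fun t => f (a * t + b)) =
  (fun t => a ^+ m * derive1n m f (a * t + b)).
Proof.
move=> sf; elim: m => [|m IH].
  by apply/funext => t; rewrite /= expr0 mul1r.
have sfm := smooth_derive1n m sf.
rewrite derive1nS IH; apply/funext => x.
have : (fun t => a ^+ m * derive1n m f (a * t + b)) =
    a ^+ m \*: (fun t => derive1n m f (a * t + b)) by [].
move=> ->; rewrite derive1E deriveZ/=; last first.
  by apply: derivable_affine => y; exact: smooth_derivable.
rewrite -derive1E derive1_affine; last by move=> y; exact: smooth_derivable.
by rewrite /GRing.scale/= mulrA -exprSr -derive1nS.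
Qed.

(* The span of the functions [flat k] is closed under derivation. *)
Definition flat k (x : R) : R :=
  if 0 < x then x^-1 ^+ k * expR (- x^-1) else 0.

Lemma flat_ge0 k x : 0 <= flat k x.
Proof.
rewrite /flat; case: ifP => // x0.
by rewrite mulr_ge0 ?expR_ge0// exprn_ge0// invr_ge0 ltW.
Qed.

Lemma flat_le k x : flat k x <= (k.+2)`!%:R * x ^+ 2.
Proof.
rewrite /flat; case: ifPn => [x0|_]; last by rewrite mulr_ge0// sqr_ge0.
have x10 : 0 < x^-1 by rewrite invr_gt0.
have := expR_ge1Dxn k.+1 (ltW x10); rewrite expRN => h.
rewrite ler_pdivrMr ?expR_gt0//.
have h2 : x^-1 ^+ k.+2 <= (k.+2)`!%:R * expR x^-1.
  have f0 : 0 < (k.+2)`!%:R :> R by rewrite ltr0n fact_gt0.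
  rewrite -ler_pdivrMl// mulrC; apply: le_trans h; by rewrite lerDr.
rewrite (_ : x^-1 ^+ k = x ^+ 2 * x^-1 ^+ k.+2).
  by rewrite [leRHS]mulrAC [leRHS]mulrC ler_pM2l// exprn_gt0.
by rewrite -[k.+2]/(2 + k)%N exprD mulrA -exprMn divff ?gt_eqF// expr1n mul1r.
Qed.

Lemma is_derive0_quad f (C : R) : (forall h, `|f h| <= C * h ^+ 2) ->
  is_derive (0 : R) 1 f 0.
Proof.
move=> fC; have f0 : f 0 = 0.
  by apply/eqP; rewrite -normr_le0; have := fC 0; rewrite expr0n/= mulr0.
suff H : (fun h => h^-1 *: (f (h *: 1 + 0) - f 0)) @ 0^' --> (0 : R).
  by apply: DeriveDef; [apply/cvg_ex; exists 0|exact: cvg_lim H].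
have C0 : 0 <= C.
  by have := le_trans (normr_ge0 _) (fC 1); rewrite expr1n mulr1.
apply: norm_cvg0.
apply: (@squeeze_cvgr _ _ _ _ (fun=> 0) (fun h => C * `|h|)).
- near=> h; rewrite normr_ge0/= f0 subr0 addr0 /GRing.scale/= mulr1.
  have h0 : h != 0 by near: h; exact: nbhs_dnbhs_neq.
  rewrite normrM normfV mulrC ler_pdivrMr ?normr_gt0// -mulrA -expr2.
  by rewrite real_normK ?num_real.
- exact: cvg_cst.
- rewrite -[X in _ --> X](mulr0 C); apply: cvgM; first exact: cvg_cst.
  rewrite -[X in _ --> X](@normr0 R R); apply: (@cvg_norm _ R^o).
  exact: nbhs_dnbhs.
Unshelve. all: by end_near. Qed.

Lemma is_derive_flat k (x : R) :
  is_derive x 1 (flat k) (- k%:R * flat k.+1 x + flat k.+2 x).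
Proof.
have [x0|x0|x0] := ltgtP x 0.
- rewrite /flat !ltNge !ltW//= mulr0 addr0.
  have h0 := @is_derive_cst R R R 0 x 1.
  apply: (near_eq_is_derive _ h0).
  near=> y; rewrite /= ifF//; apply/negbTE; rewrite -leNgt.
  by near: y; exact: lt_le_nbhsl.
- have d1 : is_derive x 1 (fun y : R => y^-1) (- x ^- 2).
    have := @is_deriveV R id x 1 1 _ _; rewrite /GRing.scale/= mulr1.
    by apply; rewrite ?gt_eqF//; exact: is_derive_id.
  have d2 : is_derive x 1 (fun y : R => expR (- y^-1)) (expR (- x^-1) * x ^- 2).
    apply: (@is_derive1_comp _ expR (fun y : R => - y^-1)).
    by rewrite -[x ^- 2]opprK; exact: is_deriveN.
  have d3 : is_derive x 1 (fun y : R => y^-1 ^+ k) (- k%:R * x^-1 ^+ k.+1).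
    have -> : (fun y : R => y^-1 ^+ k) = (fun y : R => y^-1) ^+ k.
      by apply/funext => y; elim: (k) => [//|m IH]; rewrite exprS IH [in RHS]exprS.
    have := @is_deriveX _ _ (fun y : R => y^-1) k x 1 _ d1.
    move=> h; apply: is_derive_eq; rewrite /GRing.scale/= -exprVn.
    case: (k) => [|m]; first by rewrite oppr0 !mul0r.
    by rewrite /= mulrN -mulrA -exprD addn2 mulNr.
  have d4 := is_deriveM d3 d2.
  apply: (@near_eq_is_derive _ _ _ ((fun y : R => y^-1 ^+ k) * (fun y : R => expR (- y^-1)))).
    near=> y; rewrite /flat ifT//.
    by near: y; exact: lt_nbhsr.
  apply: is_derive_eq.
  rewrite /flat x0 /GRing.scale/= -exprVn -(addn2 k) -(addn1 k) !exprD.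
  by move: (k%:R) (_ ^+ k) (expR _) => a b c; ring.
rewrite x0 /flat ltxx mulr0 addr0.
apply: (@is_derive0_quad _ (k.+2)`!%:R) => h.
by have := flat_le k h; have := flat_ge0 k h; rewrite /flat => H0; rewrite ger0_norm.
Unshelve. all: by end_near. Qed.

Lemma smooth_flat k : smooth (flat k).
Proof.
move=> m; elim: m k => [|m IH] k;
    apply: (@nsmoothS _ _ (fun x => - k%:R * flat k.+1 x + flat k.+2 x)) => [x|x|l lm].
- by have [] := is_derive_flat k x.
- by rewrite derive1E; exact: (@derive_val _ _ _ _ _ _ _ (is_derive_flat k x)).
- by [].
- by have [] := is_derive_flat k x.
- by rewrite derive1E; exact: (@derive_val _ _ _ _ _ _ _ (is_derive_flat k x)).
- apply: (@nsmooth_le m) => //; apply: nsmoothD; last exact: IH.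
  by apply: (@nsmoothM m (fun=> - k%:R)) => //; exact: nsmooth_cst.
Qed.

Definition bump (t : R) : R := flat 0 (1 * t + 2^-1) * flat 0 (-1 * t + 2^-1).

Lemma smooth_bump : smooth bump.
Proof.
by move=> k; apply: nsmoothM; apply: (@nsmooth_affine _ (flat 0)); exact: smooth_flat.
Qed.

Lemma flat_eq0 k x : x <= 0 -> flat k x = 0.
Proof. by rewrite /flat leNgt => /negbTE ->. Qed.

Lemma flat0_le1 x : flat 0 x <= 1.
Proof.
rewrite /flat; case: ifPn => // x0.
by rewrite expr0 mul1r expR_le1 oppr_le0 invr_ge0 ltW.
Qed.

Lemma flat0_gt0 : 0 < flat 0 4^-1.
Proof. by rewrite /flat invr_gt0 ltr0n/= expr0 mul1r expR_gt0. Qed.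

Lemma flat0_nd (x y : R) : 0 < x -> x <= y -> flat 0 x <= flat 0 y.
Proof.
move=> x0 xy; have y0 := lt_le_trans x0 xy; rewrite /flat x0 y0 !expr0 !mul1r.
by rewrite ler_expR lerN2 lef_pV2.
Qed.

Lemma bump_ge0 t : 0 <= bump t.
Proof. by rewrite mulr_ge0 ?flat_ge0. Qed.

Lemma bump_le1 t : bump t <= 1.
Proof. by rewrite mulr_ile1 ?flat_ge0 ?flat0_le1. Qed.

Lemma bump_eq0 t : 2^-1 <= `|t| -> bump t = 0.
Proof.
rewrite ler_normr => /orP[H|H]; rewrite /bump.
  by rewrite [X in _ * X]flat_eq0 ?mulr0//; lra.
by rewrite flat_eq0 ?mul0r//; lra.
Qed.

Lemma bump_ge t : `|t| <= 4^-1 -> flat 0 4^-1 ^+ 2 <= bump t.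
Proof.
rewrite ler_norml => /andP[H1 H2]; rewrite /bump expr2.
by apply: ler_pM; rewrite ?flat_ge0//; apply: flat0_nd; rewrite ?invr_gt0//; lra.
Qed.

Lemma derive1n_bump_eq0 k t : 2^-1 < `|t| -> derive1n k bump t = 0.
Proof.
elim: k t => [|k IH] t ht; first by rewrite /= bump_eq0// ltW.
rewrite derive1nS derive1E.
have : is_derive t 1 (derive1n k bump) 0.
  have h0 := @is_derive_cst R R R 0 t 1.
  apply: (near_eq_is_derive _ h0); near=> s; rewrite IH//.
  near: s; have : (fun s : R => `|s|) @ t --> `|t| by exact: (@norm_continuous _ R^o).
  by move/cvgr_gt; apply.
by move=> h; exact: (@derive_val _ _ _ _ _ _ _ h).
Unshelve. all: by end_near. Qed.

Lemma derive1n_bump_bounded k : exists M, forall t, `|derive1n k bump t| <= M.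
Proof.
have /continuous_subspaceT cf := smooth_continuous (smooth_derive1n k smooth_bump).
have cn : {within `[-1, 1 : R], continuous (fun t => `|derive1n k bump t|)}.
  by move=> x; apply: continuous_comp; [exact: cf|exact: norm_continuous].
have [c _ H] := @EVT_max R (fun t => `|derive1n k bump t|) (-1) 1 ltac:(lra) cn.
exists `|derive1n k bump c| => t.
have [ht|ht] := ltP 2^-1 `|t|.
  by rewrite derive1n_bump_eq0// normr0.
by apply: H; rewrite in_itv/= -ler_norml (le_trans ht)//; lra.
Qed.

Lemma derive1n_bump_bounded_le r : exists2 M, 1 <= M &
  forall k t, (k <= r)%N -> `|derive1n k bump t| <= M.
Proof.
elim: r => [|r [M M1 HM]].
  have [M HM] := derive1n_bump_bounded 0.
  exists (Num.max M 1); first by rewrite le_max lexx orbT.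
  by move=> [|//] t _; rewrite le_max HM.
have [N HN] := derive1n_bump_bounded r.+1.
exists (Num.max M N); first by rewrite le_max M1.
move=> k t; rewrite leq_eqVlt => /orP[/eqP ->|kr].
  by rewrite le_max HN orbT.
by rewrite le_max HM.
Qed.

End smooth_real.

(** * Combinations of tensor products and their derivatives *)

Section product_functions.
Context {R : realType} {n : nat}.
Implicit Types (f : 'rV[R]_n -> R) (x v : 'rV[R]_n) (i : 'I_n).

Lemma derive_line (V : normedModType R) (f : V -> R) (x v : V) :
  'D_1 (fun h : R => f (h *: v + x)) 0 = 'D_v f x.
Proof.
have E : (fun h : R => h^-1 *: (((fun h => f (h *: v + x)) \o shift 0) (h *: 1)
      - f (0 *: v + x))) = (fun h => h^-1 *: ((f \o shift x) (h *: v) - f x)).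
  by apply/funext => h /=; rewrite addr0 scale0r add0r [h *: 1]mulr1.
by rewrite /derive E.
Qed.

Lemma is_derive_line (V : normedModType R) (f : V -> R) (x v : V) d :
  is_derive (0 : R) 1 (fun h => f (h *: v + x)) d -> is_derive x v f d.
Proof.
move=> [df dE]; apply: DeriveDef; first exact: (derivable1P f x v).2.
by rewrite -dE derive_line.
Qed.

Lemma is_derive_lineP (V : normedModType R) (f : V -> R) (x v : V) d :
  is_derive x v f d -> is_derive (0 : R) 1 (fun h => f (h *: v + x)) d.
Proof.
move=> [df dE]; apply: DeriveDef; first exact: (derivable1P f x v).1.
by rewrite -dE derive_line.
Qed.

Lemma is_derive_bigsum (A : Type) (s : seq A) (F : A -> 'rV[R]_n -> R)
    (dF : A -> R) x v :
  (forall a, is_derive x v (F a) (dF a)) ->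
  is_derive x v (fun y => \sum_(a <- s) F a y) (\sum_(a <- s) dF a).
Proof.
move=> H; elim: s => [|a s IH].
  rewrite big_nil (_ : (fun _ => _) = cst 0); first exact: is_derive_cst.
  by apply/funext => y; rewrite big_nil.
rewrite big_cons (_ : (fun _ => _) = F a + (fun y => \sum_(a <- s) F a y)).
  exact: is_deriveD.
by apply/funext => y; rewrite big_cons.
Qed.

Lemma continuous_bigsum (A : Type) (s : seq A) (F : A -> 'rV[R]_n -> R) :
  (forall a, continuous (F a)) -> continuous (fun y => \sum_(a <- s) F a y).
Proof.
move=> H; elim: s => [|a s IH] x.
  rewrite (_ : (fun _ => _) = cst 0); first exact: cst_continuous.
  by apply/funext => y; rewrite big_nil.
rewrite (_ : (fun _ => _) = F a \+ (fun y => \sum_(a <- s) F a y)).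
  by apply: continuousD; [exact: H|exact: IH].
by apply/funext => y; rewrite big_cons.
Qed.

Lemma continuous_bigprod (A : Type) (s : seq A) (F : A -> 'rV[R]_n -> R) :
  (forall a, continuous (F a)) -> continuous (fun y => \prod_(a <- s) F a y).
Proof.
move=> H; elim: s => [|a s IH] x.
  rewrite (_ : (fun _ => _) = cst 1); first exact: cst_continuous.
  by apply/funext => y; rewrite big_nil.
rewrite (_ : (fun _ => _) = F a \* (fun y => \prod_(a <- s) F a y)).
  by apply: continuousM; [exact: H|exact: IH].
by apply/funext => y; rewrite big_cons.
Qed.

Definition midx1 i : 'I_n -> nat := fun j => (j == i).

Definition tensor (g : 'I_n -> R -> R) (b : 'I_n -> nat) : 'rV[R]_n -> R :=
  fun x => \prod_i derive1n (b i) (g i) (x 0 i).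

Lemma continuous_tensor g b : (forall i, smooth (g i)) -> continuous (tensor g b).
Proof.
move=> sg; apply: continuous_bigprod => i x.
apply: (@continuous_comp _ _ _ (fun y : 'rV[R]_n => y 0 i) (derive1n (b i) (g i))).
  exact: coord_continuous.
exact/smooth_continuous/smooth_derive1n.
Qed.

Lemma is_derive_tensor g b x i : (forall i, smooth (g i)) ->
  is_derive x (delta_mx 0 i) (tensor g b)
    (tensor g (fun j => b j + midx1 i j)%N x).
Proof.
move=> sg; apply: is_derive_line.
pose c := \prod_(j < n | j != i) derive1n (b j) (g j) (x 0 j).
rewrite (_ : (fun h => _) = (fun t => c * derive1n (b i) (g i) (1 * t + x 0 i))).
  have sgi := smooth_derive1n (b i) (sg i).
  have -> : tensor g (fun j => b j + midx1 i j)%N x =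
      c * (1 * derive1n (b i).+1 (g i) (1 * 0 + x 0 i)).
    rewrite /tensor (bigD1 i)//= mulrC /midx1 eqxx addn1 mul1r mul1r add0r.
    by congr (_ * _); apply: eq_bigr => j /negbTE ->; rewrite addn0.
  rewrite derive1nS.
  have -> : (fun t => c * derive1n (b i) (g i) (1 * t + x 0 i)) =
      c \*: (fun t => derive1n (b i) (g i) (1 * t + x 0 i)) by [].
  have d1 : forall y, derivable (derive1n (b i) (g i)) y 1.
    by move=> y; exact: smooth_derivable.
  apply: is_deriveZ; apply: DeriveDef; first exact: derivable_affine.
  by rewrite -derive1E derive1_affine.
apply/funext => h; rewrite /tensor (bigD1 i)//= mulrC; congr (_ * _).
  apply: eq_bigr => j ji; rewrite !mxE eqxx/= (negbTE ji).
  by rewrite mulr0 add0r.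
by rewrite !mxE !eqxx mulr1 mul1r.
Qed.

Section combinations.
Context {A : finType} (c : A -> R) (g : A -> 'I_n -> R -> R).
Hypothesis sg : forall a i, smooth (g a i).

Definition tensors (b : 'I_n -> nat) : 'rV[R]_n -> R :=
  fun x => \sum_a c a * tensor (g a) b x.

Lemma continuous_tensors b : continuous (tensors b).
Proof.
apply: continuous_bigsum => a x; apply: continuousM; first exact: cst_continuous.
exact: continuous_tensor.
Qed.

Lemma is_derive_tensors b x i :
  is_derive x (delta_mx 0 i) (tensors b) (tensors (fun j => b j + midx1 i j)%N x).
Proof.
apply: is_derive_bigsum => a.
have -> : (fun y => c a * tensor (g a) b y) = c a \*: tensor (g a) b by [].
by apply: is_deriveZ; exact: is_derive_tensor.
Qed.

Lemma derivable_tensors b x i : derivable (tensors b) x (delta_mx 0 i).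
Proof. by have [] := is_derive_tensors b x i. Qed.

Lemma partial_tensors b i : partial i (tensors b) = tensors (fun j => b j + midx1 i j)%N.
Proof.
apply/funext => x; exact: (@derive_val _ _ _ _ _ _ _ (is_derive_tensors b x i)).
Qed.

Lemma Ck_tensors k b : Ck k (tensors b).
Proof.
elim: k b => [|k IH] b; split; try exact: continuous_tensors.
  by [].
move=> i; split; first by move=> x; exact: derivable_tensors.
by rewrite partial_tensors.
Qed.

Lemma mpartial_tensors a b : mpartial a (tensors b) = tensors (fun j => a j + b j)%N.
Proof.
rewrite /mpartial.
have H k i b' : iter k (partial i) (tensors b') =
    tensors (fun j => b' j + (if j == i then k else 0))%N.
  elim: k => [|k IH] /=.
    by congr tensors; apply/funext => j; case: eqP; rewrite addn0.
  rewrite IH partial_tensors; congr tensors; apply/funext => j.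
  by rewrite /midx1; case: eqP => _; lia.
have -> : forall s : seq 'I_n, uniq s -> foldr (fun i => iter (a i) (partial i)) (tensors b) s =
    tensors (fun j => b j + (if j \in s then a j else 0))%N.
- elim=> [_|i s IH /= /andP[si us]] /=.
    by congr tensors; apply/funext => j; rewrite addn0.
  rewrite IH// H; congr tensors; apply/funext => j; rewrite inE.
  by case: eqP => [->|_] /=; rewrite ?(negbTE si) ?addn0.
- by congr tensors; apply/funext => j; rewrite mem_enum addnC.
- exact: enum_uniq.
Qed.

End combinations.
End product_functions.

Section compact_support.
Context {R : realType} {n : nat}.
Implicit Types (C G : set 'rV[R]_n) (w f : 'rV[R]_n -> R).
Local Notation mu := (lebesgue_rV R n).

Lemma continuous_compact_bounded C f : compact C -> continuous f ->
  exists2 M, 0 < M & forall x, C x -> `|f x| <= M.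
Proof.
move=> cC cf.
have [M [Mr HM]] : bounded_set (f @` C).
  by apply: compact_bounded; apply: continuous_compact => //; exact: continuous_subspaceT.
exists (`|M| + 1); first by rewrite ltr_wpDl.
by move=> x Cx; apply: (HM (`|M| + 1)); [rewrite ltr_pwDr// ler_norm|exists x].
Qed.

Lemma integrable_locally_mul G w C f : measurable G ->
  locally_Lebesgue_integrable G w -> compact C -> C `<=` G ->
  continuous f -> (forall x, ~ C x -> f x = 0) ->
  mu.-integrable G (fun x => (w x * f x)%:E).
Proof.
move=> mG [mw iw] cC CG cf f0.
have mC := compact_measurable_rV cC.
have [M M0 HM] := continuous_compact_bounded cC cf.
have mwC : measurable_fun C w by exact: measurable_funS mw.
have mfC D : measurable_fun D f.
  by apply: measurable_funTS; exact: continuous_measurable_rV.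
have : mu.-integrable C (fun x => (w x * f x)%:E).
  apply: (@le_integrable _ _ _ _ _ _ _ (fun x => M%:E * (w x)%:E)%E) => //.
  - by apply/measurable_EFinP; apply: measurable_funM.
  - move=> x Cx; rewrite -EFinM !abse_EFin lee_fin !normrM mulrC (gtr0_norm M0).
    by rewrite ler_wpM2r// HM.
  - apply: integrableZl => //; apply/integrableP; split; last exact: iw.
    exact/measurable_EFinP.
move=> /(integrable_mkcond _ mC) h; apply/(integrable_mkcond _ mG).
rewrite (_ : _ \_ G = (fun x => (w x * f x)%:E) \_ C) //.
apply/funext => x; rewrite /patch; case: ifPn => xG; case: ifPn => // xC.
  by rewrite f0 ?mulr0//; move/negP: xC; rewrite inE.
by rewrite inE in xC; rewrite notin_setE in xG; case: (xG (CG _ xC)).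
Qed.

Lemma locally_Lebesgue_integrable_continuous G f : measurable G -> continuous f ->
  locally_Lebesgue_integrable G f.
Proof.
move=> mG cf; split; first by apply: measurable_funTS; exact: continuous_measurable_rV.
move=> C cC CG; have [M M0 HM] := continuous_compact_bounded cC cf.
have mC := compact_measurable_rV cC.
apply: (@le_lt_trans _ _ (\int[mu]_(x in C) M%:E)%E).
  apply: ge0_le_integral => //.
  apply/measurable_EFinP; apply: measurableT_comp => //.
  by apply: measurable_funTS; exact: continuous_measurable_rV.
by rewrite integral_cst// lte_mul_pinfty ?lee_fin ?ltW//; exact: lebesgue_rV_compact.
Qed.

Lemma integrable_compact_support C f : compact C -> continuous f ->
  (forall x, ~ C x -> f x = 0) -> mu.-integrable setT (EFin \o f).
Proof.
move=> cC cf f0.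
have := @integrable_locally_mul setT (fun=> 1) C f.
under [X in _ -> _ -> _ -> _ -> _ -> _ -> _.-integrable _ X]funext do rewrite mul1r.
apply => //; apply: locally_Lebesgue_integrable_continuous => //.
exact: cst_continuous.
Qed.

End compact_support.

Section rV_cons_lines.
Context {R : realType} {n : nat}.
Implicit Types (t : R) (y : 'rV[R]_n) (F : 'rV[R]_n.+1 -> R).

Lemma rV_cons_line0 t y (h : R) :
  h *: delta_mx 0 ord0 + rV_cons (t, y) = rV_cons (h + t, y).
Proof.
apply/rowP => i; rewrite !mxE; case: unliftP => [j ->|->] /=.
  by rewrite mulr0 add0r.
by rewrite mulr1.
Qed.

Lemma rV_cons_line t y (j : 'I_n) (h : R) :
  h *: delta_mx 0 (lift ord0 j) + rV_cons (t, y) =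
  rV_cons (t, h *: delta_mx 0 j + y).
Proof.
apply/rowP => i; rewrite !mxE; case: unliftP => [k ->|->] /=.
  by rewrite !mxE (inj_eq (@lift_inj _ _)).
by rewrite mulr0 add0r.
Qed.

Lemma ball_rV_cons t y t' y' (r : R) : 0 < r ->
  ball (rV_cons (t, y) : 'rV[R]_n.+1) r (rV_cons (t', y')) <-> `|t - t'| < r /\ ball y r y'.
Proof.
move=> r0; split.
  move=> /(ball_rVP _ _ r0) H; split; first by have := H ord0; rewrite !mxE unlift_none.
  by apply/ball_rVP => // j; have := H (lift ord0 j); rewrite !mxE liftK.
move=> [H1 /(ball_rVP _ _ r0) H2]; apply/ball_rVP => // i.
by case: (unliftP ord0 i) => [j|] ->; rewrite !mxE ?liftK ?unlift_none.
Qed.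

Lemma continuous_rV_consl y : continuous (fun t => rV_cons (t, y) : 'rV[R]_n.+1).
Proof.
move=> t; apply/cvg_ballP => e e0; near=> s.
apply/ball_rV_cons => //; split; last exact: ballxx.
near: s; exact: (@cvgr_dist_lt _ R^o).
Unshelve. all: by end_near. Qed.

Lemma continuous_rV_consr t : continuous (fun y => rV_cons (t, y) : 'rV[R]_n.+1).
Proof.
move=> y; have FF := nbhs_filter y; apply/cvg_ballP => e e0.
have : nbhs y (ball y e) := nbhsx_ballx y e e0; apply: filterS => z yz.
by apply/ball_rV_cons => //; split => //; rewrite subrr normr0.
Qed.

Lemma norm_rV_consl t y : `|t| <= `|rV_cons (t, y) : 'rV[R]_n.+1|.
Proof.
by have := ler_norm_coord (rV_cons (t, y)) ord0; rewrite mxE unlift_none.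
Qed.

Lemma norm_rV_consr t y : `|y| <= `|rV_cons (t, y) : 'rV[R]_n.+1|.
Proof.
apply/norm_rVP => // j.
by have := ler_norm_coord (rV_cons (t, y)) (lift ord0 j); rewrite mxE liftK.
Qed.

Lemma is_derive_rV_consl F t y : derivable F (rV_cons (t, y)) (delta_mx 0 ord0) ->
  is_derive t 1 (fun s => F (rV_cons (s, y))) (partial ord0 F (rV_cons (t, y))).
Proof.
move=> dF; apply: is_derive_line.
have := is_derive_lineP (derivableP dF); congr is_derive.
by apply/funext => h; rewrite rV_cons_line0 [h *: 1]mulr1.
Qed.

Lemma is_derive_rV_consr F t y (j : 'I_n) :
  derivable F (rV_cons (t, y)) (delta_mx 0 (lift ord0 j)) ->
  is_derive y (delta_mx 0 j) (fun z => F (rV_cons (t, z)))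
    (partial (lift ord0 j) F (rV_cons (t, y))).
Proof.
move=> dF; apply: is_derive_line.
have := is_derive_lineP (derivableP dF); congr is_derive.
by apply/funext => h; rewrite rV_cons_line.
Qed.

End rV_cons_lines.

(** * Integration by parts against test functions *)

Section divergence.
Context {R : realType}.

Lemma closed_ball_compact n (M : R) : compact [set x : 'rV[R]_n | `|x| <= M].
Proof.
apply: bounded_closed_compact.
  exists M; split; first exact: num_real.
  by move=> N MN x /= xM; rewrite (le_trans xM)// ltW.
rewrite (_ : mkset _ = Num.norm @^-1` [set y : R | y <= M]) //.
by apply: closed_comp; [move=> x _; exact: norm_continuous|exact: closed_le].
Qed.

Lemma integral_rV_cons n (f : 'rV[R]_n.+1 -> R) : measurable_fun setT f ->
  (lebesgue_rV R n.+1).-integrable setT (EFin \o f) ->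
  (\int[lebesgue_rV R n.+1]_x (f x)%:E =
   \int[(@lebesgue_measure R \x lebesgue_rV R n)%E]_z (f (rV_cons z))%:E)%E /\
  (@lebesgue_measure R \x lebesgue_rV R n)%E.-integrable setT
    (fun z => (f (rV_cons z))%:E).
Proof.
move=> mf intf.
pose mu := (@lebesgue_measure R \x lebesgue_rV R n)%E.
have mF : measurable_fun setT (EFin \o f) by exact/measurable_EFinP.
have int' : mu.-integrable setT (fun z => (f (rV_cons z))%:E).
  apply/integrableP; split.
    by apply: (measurableT_comp mF); exact: measurable_rV_cons.
  move/integrableP : intf => [_]; apply: le_lt_trans.
  rewrite le_eqVlt; apply/orP; left; apply/eqP.
  have := @ge0_integral_pushforward _ _ _ _ R _ (@measurable_rV_cons R n) mu setT
    (fun x => `|(f x)%:E|%E) measurableT.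
  rewrite preimage_setT => /(_ _ _)/esym; apply => //.
  exact: measurableT_comp.
split => //.
have := @integral_pushforward _ _ _ _ R _ (@measurable_rV_cons R n) mu setT
  (EFin \o f) mF.
by rewrite preimage_setT => /(_ int' measurableT).
Qed.

Lemma integral_derive1_eq0 (f df : R -> R) (M : R) : 0 < M -> continuous df ->
  (forall t, is_derive (t : R) 1 f (df t)) -> (forall t, M <= `|t| -> f t = 0) ->
  (forall t, M <= `|t| -> df t = 0) ->
  (\int[@lebesgue_measure R]_t (df t)%:E = 0)%E.
Proof.
move=> M0 cdf dff f0 df0.
have -> : (\int[@lebesgue_measure R]_t (df t)%:E =
    \int[@lebesgue_measure R]_(t in `[(- M)%R, M]) (df t)%:E)%E.
  rewrite [RHS]integral_mkcond; apply: eq_integral => t _.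
  rewrite patchE; case: ifPn => //; rewrite notin_setE/= in_itv/= -ler_norml.
  by move/negP; rewrite -ltNge => /ltW/df0 ->.
have df1 t : derivable f t 1 by have [] := dff t.
have cf : continuous f.
  by move=> t; apply/differentiable_continuous/derivable1_diffP.
rewrite (@continuous_FTC2 _ df f).
- by rewrite !f0 ?normrN ?gtr0_norm// subee.
- by rewrite gtrN.
- exact: continuous_subspaceT.
- split => //.
    exact/cvg_at_right_filter/cf.
  exact/cvg_at_left_filter/cf.
- move=> t _; rewrite derive1E; exact: (@derive_val _ _ _ _ _ _ _ (dff t)).
Qed.

Lemma integral_partial_eq0 n (i : 'I_n) (F : 'rV[R]_n -> R) (M : R) : 0 < M ->
  (forall x, derivable F x (delta_mx 0 i)) -> continuous (partial i F) ->
  (forall x, M <= `|x| -> F x = 0) ->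
  (forall x, M <= `|x| -> partial i F x = 0) ->
  (\int[lebesgue_rV R n]_x (partial i F x)%:E = 0)%E.
Proof.
elim: n i F => [[]//|n IH] i F M0 dF cF F0 dF0.
have mF := continuous_measurable_rV cF.
have iF : (lebesgue_rV R n.+1).-integrable setT (EFin \o partial i F).
  apply: (integrable_compact_support (@closed_ball_compact n.+1 M)) => // x /=.
  by move/negP; rewrite -ltNge => /ltW/dF0.
have [-> iF'] := integral_rV_cons mF iF.
case: (unliftP ord0 i) => [j|] ij; subst i.
  rewrite -integral12_prod_meas1//.
  under eq_integral => t _.
    rewrite /fubini_F.
    under eq_integral => y _.
      rewrite (_ : partial _ _ _ = partial j (fun z => F (rV_cons (t, z))) y); last first.
        by apply/esym; exact: (@derive_val _ _ _ _ _ _ _ (is_derive_rV_consr (dF _))).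
      over.
    over.
  apply: integral0_eq => t _.
  have E : partial j (fun z => F (rV_cons (t, z))) =
      (fun z => partial (lift ord0 j) F (rV_cons (t, z))).
    by apply/funext => y; exact: (@derive_val _ _ _ _ _ _ _ (is_derive_rV_consr (dF _))).
  apply: IH => //.
  - by move=> y; have [] := is_derive_rV_consr (dF (rV_cons (t, y))).
  - rewrite E => y; apply: continuous_comp; [exact: continuous_rV_consr|exact: cF].
  - by move=> y My; apply: F0; rewrite (le_trans My)//; exact: norm_rV_consr.
  - by move=> y My; rewrite E dF0// (le_trans My)//; exact: norm_rV_consr.
rewrite -integral21_prod_meas1//; apply: integral0_eq => y _.
apply: (@integral_derive1_eq0 (fun t => F (rV_cons (t, y)))
  (fun t => partial ord0 F (rV_cons (t, y))) M) => //.
- by move=> t; apply: continuous_comp; [exact: continuous_rV_consl|exact: cF].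
- by move=> t; exact: is_derive_rV_consl.
- by move=> t Mt; apply: F0; rewrite (le_trans Mt)//; exact: norm_rV_consl.
- by move=> t Mt; apply: dF0; rewrite (le_trans Mt)//; exact: norm_rV_consl.
Qed.

End divergence.

Section test_functions.
Context {R : realType} {n : nat}.
Implicit Types (f g phi : 'rV[R]_n -> R) (G E C : set 'rV[R]_n) (a b : 'I_n -> nat).
Local Notation mu := (lebesgue_rV R n).

Lemma Ck_continuous k f : Ck k f -> continuous f.
Proof. by case: k => [|k] []. Qed.

Lemma test_function_partial G phi i : test_function G phi ->
  test_function G (partial i phi).
Proof.
move=> [sphi [C [cC CG phi0]]]; split; first by move=> k; have [_ /(_ i)[]] := sphi k.+1.
exists C; split => // x Cx; rewrite /partial.
have oC : open (~` C) by apply: closed_openC; exact: compact_closed.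
have h0 := @is_derive_cst R 'rV[R]_n R 0 x (delta_mx 0 i).
have h : is_derive x (delta_mx 0 i) phi 0.
  apply: (near_eq_is_derive _ h0).
  have : nbhs x (~` C) by exact: open_nbhs_nbhs.
  by apply: filterS => y Cy; rewrite phi0.
exact: (@derive_val _ _ _ _ _ _ _ h).
Qed.

Lemma test_function_iter_partial G phi i k : test_function G phi ->
  test_function G (iter k (partial i) phi).
Proof. by elim: k => //= k IH /IH; exact: test_function_partial. Qed.

Lemma test_function_foldr G phi a (s : seq 'I_n) : test_function G phi ->
  test_function G (foldr (fun i => iter (a i) (partial i)) phi s).
Proof. by elim: s => //= i s IH /IH; exact: test_function_iter_partial. Qed.

Lemma test_function_mpartial G phi a : test_function G phi ->
  test_function G (mpartial a phi).
Proof. exact: test_function_foldr. Qed.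

Lemma test_functionS E G phi : E `<=` G -> test_function E phi -> test_function G phi.
Proof.
move=> EG [sphi [C [cC CE phi0]]]; split=> //; exists C; split => //.
exact: subset_trans EG.
Qed.

Lemma integral_support E G (f : 'rV[R]_n -> \bar R) : E `<=` G ->
  (forall x, G x -> ~ E x -> f x = 0%E) ->
  (\int[mu]_(x in G) f x = \int[mu]_(x in E) f x)%E.
Proof.
move=> EG f0; rewrite integral_mkcond [RHS]integral_mkcond.
apply: eq_integral => x _; rewrite /patch; case: ifPn => xG; case: ifPn => // xE.
  by apply: f0; [rewrite inE in xG|rewrite notin_setE in xE].
by rewrite inE in xE; rewrite notin_setE in xG; case: (xG (EG _ xE)).
Qed.

Lemma test_function_integrable G w phi : measurable G ->
  locally_Lebesgue_integrable G w -> test_function G phi ->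
  mu.-integrable G (fun x => (w x * phi x)%:E).
Proof.
move=> mG lw [sphi [C [cC CG phi0]]].
apply: (integrable_locally_mul mG lw cC CG) => //.
exact: (Ck_continuous (sphi 0%N)).
Qed.

Lemma adde_eq0_opp (x y : \bar R) : x \is a fin_num -> y \is a fin_num ->
  (x + y = 0 -> x = - y)%E.
Proof.
by move: x y => [x| |] [y| |] //= _ _ [] /eqP; rewrite addr_eq0 => /eqP ->.
Qed.

Lemma compact_norm_lt C : compact C -> exists2 M : R, 0 < M &
  forall x, M <= `|x| -> ~ C x.
Proof.
move=> cC; have [M [_ HM]] := compact_bounded cC.
exists (`|M| + 2); first by rewrite ltr_wpDl.
move=> x xM Cx; have := HM (`|M| + 1) _ x Cx.
rewrite ltr_pwDr ?ler_norm// => /(_ isT) h; have := le_trans xM h.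
by rewrite lerD2l lern1.
Qed.

Section tensors_by_parts.
Context {A : finType} (c : A -> R) (t : A -> 'I_n -> R -> R).
Hypothesis st : forall (a : A) i, smooth (t a i).
Local Notation P := (tensors c t).

Lemma tensors_by_parts b G phi i : test_function G phi ->
  (\int[mu]_(x in G) (P b x * partial i phi x)%:E =
   - \int[mu]_(x in G) (P (fun j => b j + midx1 i j)%N x * phi x)%:E)%E.
Proof.
move=> tphi; have [sphi [C [cC CG phi0]]] := tphi.
have [sdphi [C' [cC' CG' dphi0]]] := test_function_partial i tphi.
have cphi := Ck_continuous (sphi 0%N); have cdphi := Ck_continuous (sdphi 0%N).
have [_ /(_ i)[dphi _]] := sphi 1%N.
pose b' := (fun j => b j + midx1 i j)%N.
rewrite -/b'.
have -> : (\int[mu]_(x in G) (P b x * partial i phi x)%:E =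
    \int[mu]_x (P b x * partial i phi x)%:E)%E.
  apply/esym; apply: integral_support => // x _ Gx.
  by rewrite dphi0 ?mulr0// => /CG'.
have -> : (\int[mu]_(x in G) (P b' x * phi x)%:E = \int[mu]_x (P b' x * phi x)%:E)%E.
  apply/esym; apply: integral_support => // x _ Gx.
  by rewrite phi0 ?mulr0// => /CG.
have lP d : locally_Lebesgue_integrable setT (P d).
  by apply: locally_Lebesgue_integrable_continuous => //; exact: continuous_tensors.
have i1 : mu.-integrable setT (fun x => (P b x * partial i phi x)%:E).
  exact: (integrable_locally_mul _ (lP b) cC').
have i2 : mu.-integrable setT (fun x => (P b' x * phi x)%:E).
  exact: (integrable_locally_mul _ (lP b') cC).
have pE : partial i (P b \* phi) = (P b \* partial i phi) \+ (P b' \* phi).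
  apply/funext => x; rewrite /partial deriveM//; last exact: derivable_tensors.
  have -> : 'D_(delta_mx 0 i) (P b) x = P b' x.
    by rewrite -[LHS]/(partial i (P b) x) partial_tensors.
  by rewrite /= /GRing.scale/= [phi x * _]mulrC.
have [M M0 HM] := compact_norm_lt cC; have [M' M'0 HM'] := compact_norm_lt cC'.
have := @integral_partial_eq0 R n i (P b \* phi) (Num.max M M').
rewrite pE; under eq_integral do rewrite /= EFinD.
rewrite integralD//= => H; apply: adde_eq0_opp; rewrite ?integrable_fin_num//.
apply: H => [|x||x|x].
- by rewrite lt_max M0.
- by apply: derivableM => //; exact: derivable_tensors.
- move=> x; apply: continuousD; apply: continuousM; try exact: continuous_tensors.
  + exact: cdphi.
  + exact: cphi.
- by rewrite ge_max => /andP[Mx _]; rewrite phi0 ?mulr0//; exact: HM.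
- rewrite ge_max => /andP[Mx M'x]; rewrite phi0 ?mulr0 ?addr0; last exact: HM.
  by rewrite dphi0 ?mulr0//; exact: HM'.
Qed.

Lemma tensors_by_parts_iter b G phi i k : test_function G phi ->
  (\int[mu]_(x in G) (P b x * iter k (partial i) phi x)%:E =
   ((-1) ^+ k)%:E *
   \int[mu]_(x in G) (P (fun j => b j + (if j == i then k else 0))%N x * phi x)%:E)%E.
Proof.
move=> tphi; elim: k b => [|k IH] b.
  rewrite expr0 mul1e; apply: eq_integral => x _; congr (_ * _)%:E.
  by congr tensors; apply/funext => j; case: eqP; rewrite addn0.
rewrite iterS tensors_by_parts; last exact: test_function_iter_partial.
rewrite IH exprS mulN1r EFinN mulNe; congr (- (_ * _))%E.
apply: eq_integral => x _; congr (_ * _)%:E.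
by congr tensors; apply/funext => j; rewrite /midx1; case: eqP => _; lia.
Qed.

Lemma tensors_by_parts_mpartial b G phi a : test_function G phi ->
  (\int[mu]_(x in G) (P b x * mpartial a phi x)%:E =
   ((-1) ^+ midx_order a)%:E *
   \int[mu]_(x in G) (mpartial a (P b) x * phi x)%:E)%E.
Proof.
move=> tphi; rewrite mpartial_tensors// /mpartial /midx_order -(big_enum _ _ predT)/=.
have : uniq (enum 'I_n) by exact: enum_uniq.
have -> : (fun j => a j + b j)%N = (fun j => b j + (if j \in enum 'I_n then a j else 0))%N.
  by apply/funext => j; rewrite mem_enum addnC.
elim: (enum _) b => [|i s IH] b /=.
  move=> _; rewrite big_nil expr0 mul1e; apply: eq_integral => x _.
  by congr (_ * _)%:E; congr tensors; apply/funext => j; rewrite addn0.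
move=> /andP[si us]; rewrite tensors_by_parts_iter; last exact: test_function_foldr.
rewrite IH// muleA -EFinM -exprD big_cons; congr (_ * _)%E.
apply: eq_integral => x _; congr (_ * _)%:E.
congr tensors; apply/funext => j; rewrite inE.
by case: eqP => [->|_] /=; rewrite ?(negbTE si) ?addn0.
Qed.

Lemma is_weak_derivative_tensors b G a : open G ->
  is_weak_derivative G a (P b) (mpartial a (P b)).
Proof.
move=> oG; have mG := open_measurable_rV oG; split.
- by apply: locally_Lebesgue_integrable_continuous => //; exact: continuous_tensors.
- rewrite mpartial_tensors//.
  by apply: locally_Lebesgue_integrable_continuous => //; exact: continuous_tensors.
- by move=> phi tphi; exact: tensors_by_parts_mpartial.
Qed.

End tensors_by_parts.

Lemma locally_Lebesgue_integrableS E G w : measurable G -> measurable E -> E `<=` G ->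
  locally_Lebesgue_integrable G w -> locally_Lebesgue_integrable E w.
Proof.
move=> mG mE EG [mw iw]; split; first exact: measurable_funS mw.
by move=> C cC CE; apply: iw => //; exact: subset_trans EG.
Qed.

Lemma eq_locally_Lebesgue_integrable G w w' : (forall x, G x -> w x = w' x) ->
  locally_Lebesgue_integrable G w -> locally_Lebesgue_integrable G w'.
Proof.
move=> ww' [mw iw]; split.
  by apply: eq_measurable_fun mw => x /set_mem /ww'.
move=> C cC CG; have := iw C cC CG; congr (_ < _)%E.
by apply: eq_integral => x /set_mem /CG /ww' ->.
Qed.

Lemma locally_Lebesgue_integrableB G w w' : measurable G ->
  locally_Lebesgue_integrable G w ->
  locally_Lebesgue_integrable G w' -> locally_Lebesgue_integrable G (w \- w').
Proof.
move=> mG [mw iw] [mw' iw']; split; first exact: measurable_funB.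
move=> C cC CG; have mC := compact_measurable_rV cC.
have iC (v : 'rV[R]_n -> R) : measurable_fun G v -> (\int[mu]_(x in C) `|v x|%:E < +oo)%E ->
    mu.-integrable C (EFin \o v).
  move=> mv iv; apply/integrableP; split => //.
  by apply/measurable_EFinP; exact: measurable_funS mv.
by have /integrableP[_] := integrableB (compact_measurable_rV cC)
  (iC _ mw (iw C cC CG)) (iC _ mw' (iw' C cC CG)).
Qed.

Lemma eq_is_weak_derivative G a w w' g : (forall x, G x -> w x = w' x) ->
  is_weak_derivative G a w g -> is_weak_derivative G a w' g.
Proof.
move=> ww' [lw lg H]; split => //; first exact: eq_locally_Lebesgue_integrable lw.
move=> phi tphi; rewrite -H//.
by apply: eq_integral => x /set_mem /ww' ->.
Qed.

Lemma is_weak_derivativeS E G a w g : open G -> open E -> E `<=` G ->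
  is_weak_derivative G a w g -> is_weak_derivative E a w g.
Proof.
move=> oG oE EG [lw lg H].
have mG := open_measurable_rV oG; have mE := open_measurable_rV oE.
split; [exact: locally_Lebesgue_integrableS lw|exact: locally_Lebesgue_integrableS lg|].
move=> phi tphi; have [_ [C [_ CE phi0]]] := tphi.
have [_ [C' [_ CE' phi0']]] := test_function_mpartial a tphi.
rewrite -[LHS](@integral_support E G)//; last first.
  by move=> x _ Ex; rewrite phi0' ?mulr0// => /CE'.
rewrite H; last exact: test_functionS tphi.
rewrite (@integral_support E G)// => x _ Ex.
by rewrite phi0 ?mulr0// => /CE.
Qed.

Lemma is_weak_derivativeB G a w w' g g' : open G ->
  is_weak_derivative G a w g -> is_weak_derivative G a w' g' ->
  is_weak_derivative G a (w \- w') (g \- g').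
Proof.
move=> oG [lw lg H] [lw' lg' H']; have mG := open_measurable_rV oG.
split; [exact: locally_Lebesgue_integrableB|exact: locally_Lebesgue_integrableB|].
move=> phi tphi; have tdphi := test_function_mpartial a tphi.
under eq_integral do rewrite /= mulrBl EFinB.
rewrite integralB//; [|exact: test_function_integrable..].
rewrite H// H'//.
under [in RHS]eq_integral do rewrite /= mulrBl EFinB.
rewrite [in RHS]integralB//; [|exact: test_function_integrable..].
apply/esym/muleBr => //; apply: fin_num_adde_defr; apply: integrable_fin_num => //.
exact: test_function_integrable.
Qed.

Lemma mpartial_eq_open E f g a : open E -> (forall x, E x -> f x = g x) ->
  forall x, E x -> mpartial a f x = mpartial a g x.
Proof.
move=> oE fg.
have H1 i f' g' : (forall x, E x -> f' x = g' x) ->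
    forall x, E x -> partial i f' x = partial i g' x.
  move=> fg' x Ex; apply: near_eq_derive.
  have : nbhs x E by exact: open_nbhs_nbhs.
  by apply: filterS => y Ey; rewrite fg'.
have H2 i k f' g' : (forall x, E x -> f' x = g' x) ->
    forall x, E x -> iter k (partial i) f' x = iter k (partial i) g' x.
  by move=> fg'; elim: k => //= k IH; exact: H1.
by rewrite /mpartial; elim: (enum _) => //= i s IH; exact: H2.
Qed.

Definition monomial r (a : {ffun 'I_n -> 'I_r}) (i : 'I_n) (t : R) : R := t ^+ a i.

Lemma polynomial_lt_tensors r (p : 'rV[R]_n -> R) : polynomial_lt r p ->
  exists c, p = tensors c (@monomial r) (fun=> 0%N).
Proof.
move=> [c pc]; exists c; apply/funext => x; rewrite pc.
by apply: eq_bigr => a _; congr (_ * _).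
Qed.

Lemma smooth_monomial r (a : {ffun 'I_n -> 'I_r}) i : smooth (monomial a i).
Proof. by move=> k; exact: nsmoothX. Qed.

(* On an element, [D^gamma] annihilates the discrete function, so that testing
   against [D^b phi] gives the moment of [D^gamma u] against [phi]. *)
Lemma weakD_error_moment r E G u v a b gam g :
  open G -> open E -> E `<=` G ->
  (exists ga, is_weak_derivative G a u ga) ->
  is_weak_derivative G gam u g ->
  (exists2 P, polynomial_lt r P & forall x, E x -> v x = P x) ->
  (forall x, E x -> mpartial gam v x = 0) ->
  (forall i, gam i = a i + b i)%N ->
  is_weak_derivative E a (u \- v) (weakD E a (u \- v)) /\
  forall (t : unit -> 'I_n -> R -> R) (c : unit -> R), (forall e i, smooth (t e i)) ->
    let phi := tensors c t (fun=> 0%N) in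
    test_function E phi ->
    (`| \int[mu]_(x in E) (g x * phi x)%:E | =
     `| \int[mu]_(x in E) (weakD E a (u \- v) x * tensors c t b x)%:E |)%E.
Proof.
move=> oG oE EG [ga wa] wg [P Ppoly vP] v0 gamE.
have [c Pc] := polynomial_lt_tensors Ppoly.
have wP := @is_weak_derivative_tensors _ c _ (@smooth_monomial r) (fun=> 0%N) E a oE.
have wv : is_weak_derivative E a v (mpartial a P).
  apply: (@eq_is_weak_derivative _ _ P); first by move=> x /vP.
  by rewrite Pc.
have wE : is_weak_derivative E a (u \- v) (weakD E a (u \- v)).
  have := is_weak_derivativeB oE (is_weak_derivativeS oG oE EG wa) wv.
  move=> h; apply: (@xgetPex _ (cst 0) [set g | is_weak_derivative E a (u \- v) g]).
  by exists (ga \- mpartial a P).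
split => // t d st phi tphi; have mE := open_measurable_rV oE.
have [_ _ HE] := wE.
have dphi (e : 'I_n -> nat) : mpartial e phi = tensors d t e.
  by rewrite mpartial_tensors//; congr tensors; apply/funext => j; rewrite addn0.
have tb : test_function E (tensors d t b) by rewrite -dphi; exact: test_function_mpartial.
have := HE _ tb; rewrite mpartial_tensors//.
have -> : (fun j => a j + b j)%N = gam by apply/funext => j.
rewrite -dphi.
have [lu lg Hg] := is_weak_derivativeS oG oE EG wg.
have [lv _ _] := wv.
under eq_integral do rewrite /= mulrBl EFinB.
have tgam := test_function_mpartial gam tphi.
rewrite integralB//; [|exact: test_function_integrable..].
rewrite Hg//.
have -> : (\int[mu]_(x in E) (v x * mpartial gam phi x)%:E = 0)%E.
  transitivity (\int[mu]_(x in E) (P x * mpartial gam phi x)%:E)%E.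
    by apply: eq_integral => x /set_mem /vP ->.
  rewrite Pc tensors_by_parts_mpartial//; last exact: smooth_monomial.
  rewrite [X in (_ * X)%E]integral0_eq ?mule0// => x Ex.
  have := mpartial_eq_open gam oE vP Ex; rewrite v0// Pc => <-.
  by rewrite mul0r.
rewrite sube0 => /(congr1 abse); rewrite !abseM.
by rewrite !abse_EFin !normrX !normrN !normr1 !expr1n !mul1e.
Qed.

End test_functions.

(** * Density of the continuous functions in L1 *)

Section density.
Context {R : realType} {n : nat}.
Local Notation mu := (lebesgue_rV R n).
Variable Q : set 'rV[R]_n.
Hypotheses (mQ : measurable Q) (fQ : (mu Q < +oo)%E).
Implicit Types (f g h : 'rV[R]_n -> R) (A B : set 'rV[R]_n).

Definition L1_approximable h := measurable_fun setT h /\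
  forall e : R, 0 < e -> exists2 f, continuous f &
    (\int[mu]_(x in Q) `|h x - f x|%:E <= e%:E)%E.

Let mabs h f D : measurable_fun setT h -> measurable_fun setT f ->
  measurable_fun D (fun x => `|h x - f x|%:E).
Proof.
move=> mh mf; apply: measurable_funTS; apply/measurable_EFinP.
by apply: measurableT_comp => //; exact: measurable_funB.
Qed.

Lemma L1_approximable_close h :
  measurable_fun setT h ->
  (forall e : R, 0 < e -> exists2 h', L1_approximable h' &
    (\int[mu]_(x in Q) `|h x - h' x|%:E <= e%:E)%E) ->
  L1_approximable h.
Proof.
move=> mh H; split => // e e0; have e20 : 0 < e / 2 by lra.
have [h' [mh' Hh'] hh'] := H _ e20; have [f cf h'f] := Hh' _ e20.
have mf := continuous_measurable_rV cf.
exists f => //; rewrite [e]splitr EFinD; apply: le_trans (leeD hh' h'f).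
rewrite -ge0_integralD//; [|exact: mabs|exact: mabs].
apply: ge0_le_integral => //; first exact: mabs.
- by apply: emeasurable_funD; exact: mabs.
- by move=> x _; rewrite -EFinD lee_fin ler_distD.
Qed.

Lemma L1_approximable_comb h1 h2 (op : R -> R -> R) (a b : R) : 0 < a -> 0 < b ->
  (forall f g, continuous f -> continuous g -> continuous (fun x => op (f x) (g x))) ->
  (forall f g, measurable_fun setT f -> measurable_fun setT g ->
    measurable_fun setT (fun x : 'rV[R]_n => op (f x) (g x))) ->
  (forall s t s' t', `|op s t - op s' t'| <= a * `|s - s'| + b * `|t - t'|) ->
  L1_approximable h1 -> L1_approximable h2 ->
  L1_approximable (fun x => op (h1 x) (h2 x)).
Proof.
move=> a0 b0 cop mop lop [mh1 H1] [mh2 H2]; split; first exact: mop.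
move=> e e0.
have [f1 cf1 hf1] := H1 (e / 2 / a) ltac:(by rewrite !divr_gt0).
have [f2 cf2 hf2] := H2 (e / 2 / b) ltac:(by rewrite !divr_gt0).
have mf1 := continuous_measurable_rV cf1; have mf2 := continuous_measurable_rV cf2.
exists (fun x => op (f1 x) (f2 x)); first exact: cop.
apply: (@le_trans _ _ (a%:E * \int[mu]_(x in Q) `|h1 x - f1 x|%:E +
    b%:E * \int[mu]_(x in Q) `|h2 x - f2 x|%:E)%E).
  rewrite -!ge0_integralZl//; try exact: mabs; try by rewrite lee_fin ltW.
  rewrite -ge0_integralD//; last 4 first.
  - by move=> x _; rewrite mule_ge0// lee_fin ltW.
  - by apply: measurable_funeM; exact: mabs.
  - by move=> x _; rewrite mule_ge0// lee_fin ltW.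
  - by apply: measurable_funeM; exact: mabs.
  apply: ge0_le_integral => //.
  - by apply: mabs; exact: mop.
  - by apply: emeasurable_funD; apply: measurable_funeM; exact: mabs.
  - by move=> x _; rewrite lee_fin lop.
rewrite [X in (_ <= X%:E)%E]splitr EFinD; apply: leeD.
  apply: (@le_trans _ _ (a%:E * (e / 2 / a)%:E)%E).
    by rewrite lee_wpmul2l// lee_fin ltW.
  by rewrite -EFinM mulrC divfK// gt_eqF.
apply: (@le_trans _ _ (b%:E * (e / 2 / b)%:E)%E).
  by rewrite lee_wpmul2l// lee_fin ltW.
by rewrite -EFinM mulrC divfK// gt_eqF.
Qed.

Lemma L1_approximable_cst (a : R) : L1_approximable (fun=> a).
Proof.
split; first exact: measurable_cst.
move=> e e0; exists (fun=> a); first exact: cst_continuous.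
rewrite integral0_eq ?lee_fin ?ltW// => x _; by rewrite subrr normr0.
Qed.

Lemma L1_approximableD h1 h2 : L1_approximable h1 -> L1_approximable h2 ->
  L1_approximable (fun x => h1 x + h2 x).
Proof.
apply: (@L1_approximable_comb _ _ +%R 1 1) => // [f g cf cg x|f g mf mg|s t s' t'].
- by apply: continuousD; [exact: cf|exact: cg].
- exact: measurable_funD.
- by rewrite !mul1r opprD addrACA ler_normD.
Qed.

Lemma L1_approximableZ (k : R) h : L1_approximable h ->
  L1_approximable (fun x => k * h x).
Proof.
move=> H; apply: (@L1_approximable_comb h h (fun s _ => k * s) (`|k| + 1) 1) => //.
- by move=> f g cf _ x; apply: continuousM; [exact: cst_continuous|exact: cf].
- by move=> f g mf _; exact: measurable_funM.
- move=> s t s' t'; rewrite -mulrBr normrM mul1r mulrDl mul1r.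
  by rewrite -addrA lerDl addr_ge0.
Qed.

Lemma L1_approximable_max h1 h2 : L1_approximable h1 -> L1_approximable h2 ->
  L1_approximable (fun x => Num.max (h1 x) (h2 x)).
Proof.
apply: (@L1_approximable_comb _ _ Num.max 1 1) => // [f g cf cg x|f g mf mg|s t s' t'].
- by apply: continuous_max; [exact: cf|exact: cg].
- exact: measurable_maxr.
- rewrite !mul1r ler_norml.
  have := ler_norm (s - s'); have := ler_norm (t - t').
  have := ler_norm (- (s - s')); have := ler_norm (- (t - t')).
  rewrite !normrN; have := normr_ge0 (s - s'); have := normr_ge0 (t - t').
  move: `|s - s'| `|t - t'| => p q *.
  by case: (leP s t); case: (leP s' t') => ? ?; apply/andP; split; lra.
Qed.

Lemma small_difference A (F : nat -> set 'rV[R]_n) : (forall k, measurable (F k)) ->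
  nondecreasing_seq F -> A = \bigcup_k F k ->
  forall e : R, 0 < e -> exists k, (mu (Q `&` (A `\` F k)) <= e%:E)%E.
Proof.
move=> mF ndF AE e e0.
have mA : measurable A by rewrite AE; exact: bigcup_measurable.
have cv : (fun k => mu (Q `&` (A `\` F k))) @ \oo --> mu (\bigcap_k (Q `&` (A `\` F k))).
  apply: nonincreasing_cvg_mu.
  - apply: le_lt_trans fQ; apply: le_measure; rewrite ?inE//.
    by apply: measurableI => //; exact: measurableD.
  - by move=> k; apply: measurableI => //; exact: measurableD.
  - by apply: bigcap_measurable => // k _; apply: measurableI => //; exact: measurableD.
  - move=> k l kl; apply/subsetPset => x [Qx [Ax Fx]]; split => //; split => // Fk.
    by apply: Fx; have /subsetPset := ndF _ _ kl; apply.
have E : \bigcap_k (Q `&` (A `\` F k)) = set0.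
  apply/seteqP; split => // x H; have [_ []] := H 0%N I.
  by rewrite AE => -[k _ Fk] _; have [_ []] := H k I.
rewrite E measure0 in cv.
move/fine_cvgP : cv => [fin /cvgr_lt/(_ e e0) lte].
near \oo => k; exists k.
rewrite -[X in (X <= _)%E]fineK; last by near: k.
by rewrite lee_fin ltW//; near: k.
Unshelve. all: by end_near. Qed.

Let mI B : measurable B -> measurable_fun setT (\1_B : 'rV[R]_n -> R).
Proof. by move=> mB; exact: measurable_indic. Qed.

Lemma integral_indic_difference A B f : measurable A -> measurable B -> B `<=` A ->
  measurable_fun setT f ->
  (forall x, B x -> f x = 1) -> (forall x, ~ A x -> f x = 0) ->
  (forall x, 0 <= f x <= 1) ->
  (\int[mu]_(x in Q) `|\1_A x - f x|%:E <= mu (Q `&` (A `\` B)))%E.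
Proof.
move=> mA mB BA mf f1 f0 f01.
rewrite setIC -integral_indic//; last exact: measurableD.
apply: ge0_le_integral => //; first by apply: mabs => //; exact: mI.
  by apply/measurable_EFinP; apply: measurable_funTS; apply: mI; exact: measurableD.
move=> x _; rewrite !indicE in_setD lee_fin.
have := BA x; have := f1 x; have := f0 x.
case: (boolP (x \in A)) => /= [/set_mem|] xA;
  case: (boolP (x \in B)) => /= [/set_mem|] xB H0 H1 H2.
- by rewrite H1// subrr normr0.
- by rewrite ler_norml; have := f01 x; lra.
- by rewrite notin_setE in xA; case: (xA (H2 xB)).
- by rewrite notin_setE in xA; rewrite H0// subr0 normr0.
Qed.

Definition approximable_sets := [set A : set 'rV[R]_n |
  measurable A /\ L1_approximable (\1_A : 'rV[R]_n -> R)].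

Lemma approximable_setsC A : approximable_sets A -> approximable_sets (~` A).
Proof.
move=> [mA aA]; split; first exact: measurableC.
have -> : (\1_(~` A) : 'rV[R]_n -> R) = (fun x => 1 + (-1) * \1_A x).
  by apply/funext => x; rewrite !indicE in_setC; case: (_ \in _) => /=; lra.
by apply: L1_approximableD; [exact: L1_approximable_cst|exact: L1_approximableZ].
Qed.

Lemma approximable_setsU A B : approximable_sets A -> approximable_sets B ->
  approximable_sets (A `|` B).
Proof.
move=> [mA aA] [mB aB]; split; first exact: measurableU.
have -> : (\1_(A `|` B) : 'rV[R]_n -> R) = (fun x => Num.max (\1_A x) (\1_B x)).
  apply/funext => x; rewrite !indicE in_setU.
  by case: (_ \in A) => /=; case: (_ \in B); rewrite ?maxxx//; [rewrite max_l|rewrite max_r].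
exact: L1_approximable_max.
Qed.

Lemma approximable_sets_bigcup (F : nat -> set 'rV[R]_n) :
  (forall k, approximable_sets (F k)) -> nondecreasing_seq F ->
  approximable_sets (\bigcup_k F k).
Proof.
move=> aF ndF; have mF k : measurable (F k) by have [] := aF k.
have mA : measurable (\bigcup_k F k) by exact: bigcup_measurable.
split => //; apply: L1_approximable_close => [|e e0]; first exact: mI.
have [k hk] := small_difference mF ndF erefl e0.
exists (\1_(F k)); first by have [] := aF k.
apply: le_trans hk; apply: integral_indic_difference => //.
- exact: bigcup_sup.
- by move=> x Fx; rewrite indicE mem_set.
- by move=> x Fx; rewrite indicE memNset// => Fk; apply: Fx; exists k.
- by move=> x; rewrite indicE; case: (_ \in _); rewrite /= ?lexx ?ler01.
Qed.

Lemma sigma_algebra_approximable : sigma_algebra setT approximable_sets.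
Proof.
have a0 : approximable_sets set0.
  by split => //; rewrite indic0; exact: L1_approximable_cst.
split => //.
  by move=> A aA; rewrite setTD; exact: approximable_setsC.
move=> F aF.
pose B k := \big[setU/set0]_(i < k.+1) F i.
have aB k : approximable_sets (B k).
  by rewrite /B; elim/big_ind : _ => //; exact: approximable_setsU.
have BE : \bigcup_k F k = \bigcup_k B k.
  apply/seteqP; split => x [k _].
    by move=> Fk; exists k => //; rewrite /B -bigcup_mkord; exists k => /=.
  by rewrite /B -bigcup_mkord => -[i _ Fi]; exists i.
rewrite BE; apply: approximable_sets_bigcup => // k l kl.
apply/subsetPset; rewrite /B -!bigcup_mkord => x [i /= ik Fi]; exists i => //=.
exact: leq_trans ik _.
Qed.

Lemma approximable_slab i (a b : R) :
  approximable_sets ((fun x : 'rV[R]_n => x 0 i) @^-1` `]a, b[%classic).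
Proof.
pose m (x : 'rV[R]_n) : R := Num.min (x 0 i - a) (b - x 0 i).
have cm : continuous m.
  move=> x; apply: (@continuous_min _ _ (fun x : 'rV[R]_n => x 0 i - a) (fun x => b - x 0 i));
  apply: continuousB; try exact: cst_continuous;
  exact: coord_continuous.
set A := _ @^-1` _.
have AE x : A x <-> 0 < m x.
  by rewrite /A /m /= in_itv/= lt_min !subr_gt0; split => [|/andP[]->].
pose F k := [set x | 1 <= k.+1%:R * m x].
have ckm k : continuous (fun x => k.+1%:R * m x).
  move=> x; apply: (@continuousM _ _ (fun=> k.+1%:R) m); last exact: cm.
  exact: cst_continuous.
have mF k : measurable (F k).
  apply: closed_measurable_rV.
  rewrite (_ : F k = (fun x => k.+1%:R * m x) @^-1` [set y : R | 1 <= y])//.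
  by apply: closed_comp; [move=> x _; exact: ckm|exact: closed_ge].
have Fm k x : F k x -> 0 < m x.
  by rewrite /F/= => h; rewrite -(@pmulr_rgt0 _ k.+1%:R)//; apply: lt_le_trans h.
have ndF : nondecreasing_seq F.
  move=> k l kl; apply/subsetPset => x Fx; have := Fm _ _ Fx => m0.
  rewrite /F/= (le_trans Fx)//; apply: ler_wpM2r; first exact: ltW.
  by rewrite ler_nat ltnS.
have UF : A = \bigcup_k F k.
  apply/seteqP; split => x; last by move=> [k _ /Fm /AE].
  move=> /AE m0; have [k km] := ltr_add_invr m0; exists k => //.
  rewrite add0r in km; rewrite /F /= -(@ler_pdivrMl _ k.+1%:R)// mulr1.
  exact: ltW.
have mA : measurable A by rewrite UF; exact: bigcup_measurable.
split => //; split; first exact: mI.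
move=> e e0; have [k hk] := small_difference mF ndF UF e0.
pose f (x : 'rV[R]_n) : R := Num.max 0 (Num.min 1 (k.+1%:R * m x)).
have cf : continuous f.
  move=> x; apply: (@continuous_max _ _ (fun=> 0) (fun x => Num.min 1 (k.+1%:R * m x))).
    exact: cst_continuous.
  by apply: (@continuous_min _ _ (fun=> 1) (fun x => k.+1%:R * m x));
    [exact: cst_continuous|exact: ckm].
exists f => //; apply: le_trans hk; apply: integral_indic_difference => //.
- by rewrite UF; exact: bigcup_sup.
- exact: continuous_measurable_rV.
- by move=> x Fx; rewrite /f min_l// max_r.
- move=> x Ax; rewrite /f max_l// ge_min; apply/orP; right.
  rewrite pmulr_rle0// leNgt; apply/negP => /AE; exact.
- by move=> x; rewrite /f le_max lexx/= ge_max ler01 ge_min lexx.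
Qed.

Lemma measurable_approximable A : measurable A -> approximable_sets A.
Proof.
move: A; apply: smallest_sub; first exact: sigma_algebra_approximable.
move=> _ [i _ [B mB <-]].
have : <<s @RGenOpens.G R >> `<=`
    [set B | approximable_sets ((fun x : 'rV[R]_n => x 0 i) @^-1` B)].
  apply: smallest_sub; last first.
    by move=> _ [a [b ->]]; exact: approximable_slab.
  have [s0 sC sU] := sigma_algebra_approximable; split => /=.
  - by rewrite preimage_set0.
  - by move=> D aD; rewrite setTD preimage_setC; exact: approximable_setsC.
  - by move=> D aD; rewrite preimage_bigcup; exact: sU.
apply; rewrite -[X in X B]/((@RGenOpens.G R).-sigma.-measurable).
by rewrite -RGenOpens.measurableE.
Qed.

Import HBSimple.

Lemma L1_approximable_sfun (f : {sfun 'rV[R]_n >-> R}) : L1_approximable f.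
Proof.
have -> : (f : 'rV[R]_n -> R) =
    (fun x => \sum_(y <- finmap.enum_fset (fset_set (range f))) y * \1_(f @^-1` [set y]) x).
  apply/funext => x; rewrite [LHS]fimfunE fsbig_finite//.
elim: (finmap.enum_fset _) => [|y s IH].
  rewrite (_ : (fun _ => _) = fun=> 0); first exact: L1_approximable_cst.
  by apply/funext => x; rewrite big_nil.
rewrite (_ : (fun _ => _) = (fun x => y * \1_(f @^-1` [set y]) x +
    \sum_(y <- s) y * \1_(f @^-1` [set y]) x)).
  apply: L1_approximableD => //; apply: L1_approximableZ.
  by have [] := measurable_approximable (measurable_sfunP f (measurable_set1 y)).
by apply/funext => x; rewrite big_cons.
Qed.

Lemma integrable_continuous_approx f : mu.-integrable Q (EFin \o f) ->
  forall e : R, 0 < e -> exists2 h, continuous h &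
    (\int[mu]_(x in Q) `|f x - h x|%:E <= e%:E)%E.
Proof.
move=> intf e e0; have e20 : 0 < e / 2 by lra.
have [g [gi _ /fine_cvgP[fin /cvgr_lt/(_ _ e20) lte]]] := approximation_sfun_integrable mQ intf.
near \oo => k.
have hk : (\int[mu]_(x in Q) `|f x - g k x|%:E <= (e / 2)%:E)%E.
  rewrite -[X in (X <= _)%E]fineK; last by near: k.
  by rewrite lee_fin ltW//; near: k.
have [_ /(_ _ e20)[h ch gh]] := L1_approximable_sfun (g k).
exists h => //; rewrite [e]splitr EFinD; apply: le_trans (leeD hk gh).
have mf : measurable_fun Q f by apply/measurable_EFinP; move/integrableP : intf => [].
have mh : measurable_fun Q h by apply: measurable_funTS; exact: continuous_measurable_rV.
have mg : measurable_fun Q (g k) by apply: measurable_funTS; exact: measurable_funPT.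
have ma (a b : 'rV[R]_n -> R) : measurable_fun Q a -> measurable_fun Q b ->
    measurable_fun Q (fun x => `|a x - b x|%:E).
  move=> ha hb; apply/measurable_EFinP; apply: measurableT_comp => //.
  exact: measurable_funB.
rewrite -ge0_integralD//; [|exact: ma|exact: ma].
apply: ge0_le_integral => //; first exact: ma.
- by apply: emeasurable_funD; exact: ma.
- by move=> x _; rewrite -EFinD lee_fin ler_distD.
Unshelve. all: by end_near. Qed.

End density.

(** * Bump functions on cubes and covers by cubes *)

Section cube_bump.
Context {R : realType} {n : nat}.
Implicit Types (z y x : 'rV[R]_n) (rho : R) (b : 'I_n -> nat).
Local Notation mu := (lebesgue_rV R n).

Definition cube_bump_factor z rho (_ : unit) (i : 'I_n) (t : R) : R :=
  bump (rho^-1 * t + - (rho^-1 * z 0 i)).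

Definition cube_bump z rho b : 'rV[R]_n -> R :=
  tensors (fun=> 1) (cube_bump_factor z rho) b.

Lemma smooth_cube_bump_factor z rho e i : smooth (cube_bump_factor z rho e i).
Proof. by move=> k; apply: nsmooth_affine; exact: smooth_bump. Qed.

Lemma cube_bumpE z rho b y : cube_bump z rho b y =
  \prod_i (rho^-1 ^+ b i * derive1n (b i) bump (rho^-1 * (y 0 i - z 0 i))).
Proof.
rewrite /cube_bump /tensors /tensor (big_pred1 tt) => [|[]//]; rewrite mul1r.
apply: eq_bigr => i _; rewrite /cube_bump_factor derive1n_affine.
  by rewrite mulrBr.
exact: smooth_bump.
Qed.

Lemma cube_bump0E z rho y : cube_bump z rho (fun=> 0%N) y =
  \prod_i bump (rho^-1 * (y 0 i - z 0 i)).
Proof. by rewrite cube_bumpE; apply: eq_bigr => i _; rewrite expr0 mul1r. Qed.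

Lemma cube_bump_eq0 z rho b y : 0 < rho -> rho / 2 < `|y - z| ->
  cube_bump z rho b y = 0.
Proof.
move=> rho0 yz; rewrite cube_bumpE.
have [i yi] : exists i, rho / 2 < `|y 0 i - z 0 i|.
  apply: contrapT => /forallNP H; move: yz; rewrite ltNge => /negP; apply.
  apply/norm_rVP; first by rewrite divr_ge0// ltW.
  by move=> i; rewrite !mxE leNgt; apply/negP.
rewrite (bigD1 i)//= derive1n_bump_eq0 ?mulr0 ?mul0r//.
by rewrite normrM gtr0_norm ?invr_gt0// ltr_pdivlMl.
Qed.

Lemma cube_bump_ge0 z rho y : 0 <= cube_bump z rho (fun=> 0%N) y.
Proof. by rewrite cube_bump0E prodr_ge0// => i _; exact: bump_ge0. Qed.

Lemma cube_bump_le1 z rho y : cube_bump z rho (fun=> 0%N) y <= 1.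
Proof.
by rewrite cube_bump0E prodr_ile1// => i _; rewrite bump_ge0 bump_le1.
Qed.

Lemma cube_bump_ge z rho y : 0 < rho -> ball z (rho / 4) y ->
  (flat 0 4^-1 ^+ 2) ^+ n <= cube_bump z rho (fun=> 0%N) y.
Proof.
move=> rho0 /(ball_rVP _ _ (divr_gt0 rho0 (ltr0Sn _ 3))) H; rewrite cube_bump0E.
rewrite -[X in _ ^+ X](card_ord n) -prodr_const; apply: ler_prod => i _.
rewrite exprn_ge0 ?flat_ge0//=; apply: bump_ge.
by rewrite normrM gtr0_norm ?invr_gt0// ler_pdivrMl// distrC ltW.
Qed.

Lemma cube_bump_bound z rho b (r : nat) (M : R) y : 0 < rho -> 1 <= M ->
  (forall k t, (k <= r)%N -> `|derive1n k (@bump R) t| <= M) ->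
  (midx_order b <= r)%N ->
  `|cube_bump z rho b y| <= rho^-1 ^+ midx_order b * M ^+ n.
Proof.
move=> rho0 M1 HM br; rewrite cube_bumpE normr_prod.
rewrite /midx_order expr_sum -[X in M ^+ X](card_ord n) -prodr_const -big_split/=.
have rho1 : 0 <= rho^-1 by rewrite invr_ge0 ltW.
apply: ler_prod => i _; rewrite normr_ge0/= normrM.
rewrite ger0_norm ?exprn_ge0//; apply: ler_wpM2l; first exact: exprn_ge0.
by apply: HM; apply: leq_trans br; rewrite /midx_order (bigD1 i)//= leq_addr.
Qed.

Lemma cube_bump_support z rho : 0 < rho -> compact [set y | `|y - z| <= rho / 2] /\
  [set y | `|y - z| <= rho / 2] `<=` ball z rho.
Proof.
move=> rho0; split.
  apply: bounded_closed_compact.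
    exists (`|z| + rho); split; first exact: num_real.
    move=> N zN y /= yz; rewrite -[y](subrK z) (le_trans (ler_normD _ _))//.
    apply: le_trans (ltW zN); rewrite addrC lerD2l (le_trans yz)//; lra.
  rewrite (_ : mkset _ = (fun y => `|y - z|) @^-1` [set s : R | s <= rho / 2]) //.
  apply: closed_comp; last exact: closed_le.
  move=> y _; apply: (@continuous_comp _ _ _ (fun y => y - z) Num.norm).
    by apply: continuousB; [exact: cvg_id|exact: cst_continuous].
  exact: norm_continuous.
move=> y /= yz; rewrite -ball_normE/= distrC (le_lt_trans yz)//; lra.
Qed.

Lemma test_function_cube_bump z rho b (E : set 'rV[R]_n) : 0 < rho ->
  ball z rho `<=` E -> test_function E (cube_bump z rho b).
Proof.
move=> rho0 zE; split.
  by move=> k; apply: Ck_tensors; exact: smooth_cube_bump_factor.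
have [cC Cb] := cube_bump_support z rho0.
exists [set y | `|y - z| <= rho / 2]; split => //; first exact: subset_trans zE.
by move=> y /= /negP; rewrite -ltNge; exact: cube_bump_eq0.
Qed.

Lemma integral_cube_bump_ge z rho (E : set 'rV[R]_n) : 0 < rho ->
  measurable E -> ball z rho `<=` E ->
  (((flat 0 4^-1 ^+ 2 * (rho / 2)) ^+ n)%:E <=
   \int[mu]_(x in E) (cube_bump z rho (fun=> 0%N) x)%:E)%E.
Proof.
move=> rho0 mE zE.
have r4 : 0 < rho / 4 by rewrite divr_gt0.
have mb : measurable (ball z (rho / 4) : set 'rV[R]_n) by exact: measurable_ball_rV.
have cphi : continuous (cube_bump z rho (fun=> 0%N)).
  by apply: continuous_tensors; exact: smooth_cube_bump_factor.
have mphi D : measurable_fun D (fun x => (cube_bump z rho (fun=> 0%N) x)%:E).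
  by apply/measurable_EFinP; apply: measurable_funTS; exact: continuous_measurable_rV.
apply: (@le_trans _ _ (\int[mu]_(x in ball z (rho / 4)) ((flat 0 4^-1 ^+ 2) ^+ n)%:E)%E).
  rewrite integral_cst// [X in (_ * X)%E]lebesgue_rV_ball// -EFinM -exprMn.
  by rewrite lee_fin le_eqVlt; apply/orP; left; apply/eqP; congr (_ ^+ _); lra.
apply: (@le_trans _ _ (\int[mu]_(x in ball z (rho / 4)) (cube_bump z rho (fun=> 0%N) x)%:E)%E).
  apply: ge0_le_integral => //.
  - by move=> x _; rewrite lee_fin !exprn_ge0// flat_ge0.
  - by move=> x zx; rewrite lee_fin cube_bump_ge.
apply: ge0_subset_integral => //.
  by move=> x _; rewrite lee_fin cube_bump_ge0.
apply: subset_trans zE; apply: le_ball; lra.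
Qed.

Lemma cube_bump_moment z rho (E : set 'rV[R]_n) (f g : 'rV[R]_n -> R) (s t : R) :
  0 < rho -> open E -> ball z rho `<=` E -> locally_Lebesgue_integrable E g ->
  continuous f -> s = 1 \/ s = -1 -> 0 <= t ->
  (forall y, ball z rho y -> t <= s * f y) ->
  ((t * (flat 0 4^-1 ^+ 2 * (rho / 2)) ^+ n)%:E <=
   `|\int[mu]_(x in E) (g x * cube_bump z rho (fun=> 0%N) x)%:E| +
   \int[mu]_(x in ball z rho) `|g x - f x|%:E)%E.
Proof.
move=> rho0 oE zE lg cf s1 t0 tf; have mE := open_measurable_rV oE.
set phi := cube_bump z rho (fun=> 0%N); set F := (\int[mu]_(x in ball _ _) _)%E.
have F0 : (0 <= F)%E by exact: integral_ge0.
have tphi : test_function E phi by exact: test_function_cube_bump.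
have ig : mu.-integrable E (fun x => (g x * phi x)%:E) by exact: test_function_integrable.
have mg : measurable_fun E g by have [] := lg.
have mf : measurable_fun E f by apply: measurable_funTS; exact: continuous_measurable_rV.
have mb : measurable (ball z rho : set 'rV[R]_n) by exact: measurable_ball_rV.
have [->|Foo] := eqVneq F +oo%E.
  by rewrite addey ?leey// -ltNye (lt_le_trans _ (abse_ge0 _)).
have mphi D : measurable_fun D phi.
  apply: measurable_funTS; apply: continuous_measurable_rV.
  by apply: continuous_tensors; exact: smooth_cube_bump_factor.
have mF : measurable_fun (ball z rho) (fun x => `|g x - f x|%:E).
  apply/measurable_EFinP; apply: measurableT_comp => //; apply: measurable_funB.
    exact: measurable_funS mg.
  exact: measurable_funS mf.
have iF : mu.-integrable (ball z rho) (fun x => `|g x - f x|%:E).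
  apply/integrableP; split => //.
  by under eq_integral do rewrite /= normr_id; rewrite ltey.
have iFE : mu.-integrable E ((fun x => `|g x - f x|%:E) \_ (ball z rho)).
  apply/(integrable_mkcond _ mE);
    rewrite (_ : _ \_ E = (fun x => `|g x - f x|%:E) \_ (ball z rho)).
    exact/(integrable_mkcond _ mb).
  apply/funext => x; rewrite /patch; case: ifPn => // xE; case: ifPn => // /set_mem /zE xE'.
  by rewrite notin_setE in xE.
have FE : (F = \int[mu]_(x in E) ((fun x => `|g x - f x|%:E) \_ (ball z rho)) x)%E.
  rewrite /F (@integral_support _ _ (ball z rho) E)//; last first.
    by move=> x _ zx; rewrite patchE memNset.
  by apply: eq_integral => x xz; rewrite patchE xz.
have isg : mu.-integrable E (fun x => s%:E * (g x * phi x)%:E)%E by exact: integrableZl.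
apply: (@le_trans _ _ (s%:E * \int[mu]_(x in E) (g x * phi x)%:E + F)%E); last first.
  apply: leeD => //; case: s1 => ->; rewrite ?mul1e ?lee_abs// EFinN mulN1e.
  by rewrite -abseN lee_abs.
rewrite FE -integralZl// -integralD//.
apply: (@le_trans _ _ (t%:E * \int[mu]_(x in E) (phi x)%:E)%E).
  by rewrite EFinM lee_wpmul2l ?lee_fin//; exact: integral_cube_bump_ge.
have phi0 x : 0 <= phi x by exact: cube_bump_ge0.
rewrite -ge0_integralZl//; last 2 first.
- exact/measurable_EFinP.
- by move=> x _; rewrite lee_fin.
apply: le_integral => //.
- apply: (@integrableZl _ _ _ _ _ mE).
  rewrite (_ : (fun _ => _) = (fun x => (1 * phi x)%:E)); last first.
    by apply/funext => x; rewrite mul1r.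
  apply: (@test_function_integrable _ _ E (fun=> 1) phi mE _ tphi).
  by apply: locally_Lebesgue_integrable_continuous => //; exact: cst_continuous.
- exact: integrableD.
move=> x /set_mem Ex; rewrite patchE; case: ifPn => [/set_mem|/negP] zx.
  rewrite -!EFinM -EFinD lee_fin.
  apply: (@le_trans _ _ (s * f x * phi x)); first by rewrite ler_wpM2r// tf.
  have -> : s * f x * phi x = s * (g x * phi x) + (- s) * (g x - f x) * phi x by ring.
  rewrite lerD2l; apply: (@le_trans _ _ (`|g x - f x| * phi x)).
    rewrite ler_wpM2r//; apply: le_trans (ler_norm _) _.
    by rewrite normrM normrN; case: s1 => ->; rewrite ?normrN normr1 mul1r.
  by rewrite ler_piMr// cube_bump_le1.
rewrite (_ : phi x = 0) ?mulr0 ?mule0 ?adde0//.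
apply: cube_bump_eq0 => //; rewrite ltNge; apply/negP => xz; apply: zx; rewrite inE.
by have [_] := cube_bump_support z rho0; apply.
Qed.

End cube_bump.

Section separated_cover.
Context {R : realType} {n : nat}.
Implicit Types (C : set 'rV[R]_n) (s : R).
Local Notation mu := (lebesgue_rV R n).

Lemma separated_subseq s (S : seq 'rV[R]_n) : 0 < s -> exists D : seq 'rV[R]_n,
  [/\ uniq D, {subset D <= S},
      forall x y, x \in D -> y \in D -> x != y -> s <= `|x - y|
    & forall x, x \in S -> exists2 y, y \in D & `|x - y| < s].
Proof.
move=> s0; elim: S => [|z S [D [uD DS sepD covD]]]; first by exists [::].
have [/hasP[y yD zy]|/hasPn H] := boolP (has (fun y => `|z - y| < s) D).
  exists D; split => //; first by move=> x /DS xS; rewrite inE xS orbT.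
  move=> x; rewrite inE => /orP[/eqP ->|/covD//]; by exists y.
have zD : z \notin D by apply/negP => /H; rewrite subrr normr0 s0.
exists (z :: D); split => /=.
- by rewrite zD uD.
- by move=> x; rewrite !inE => /orP[->//|/DS ->]; rewrite orbT.
- move=> x y; rewrite !inE => /orP[/eqP ->|xD] /orP[/eqP ->|yD]; rewrite ?eqxx//.
  + by move=> _; rewrite leNgt; exact: H.
  + by move=> _; rewrite distrC leNgt; exact: H.
  + exact: sepD.
- move=> x; rewrite inE => /orP[/eqP ->|/covD[y yD xy]].
    by exists z; rewrite ?mem_head// subrr normr0.
  by exists y => //; rewrite inE yD orbT.
Qed.

Lemma separated_cover C s : compact C -> 0 < s -> exists D : seq 'rV[R]_n,
  [/\ uniq D, forall x, x \in D -> C x,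
      forall x y, x \in D -> y \in D -> x != y -> s *+ 2 <= `|x - y|
    & forall x, C x -> exists2 y, y \in D & ball y (s *+ 3) x].
Proof.
move=> cC s0; have : cover_compact C by rewrite -compact_cover.
move=> /(_ 'rV[R]_n C (fun x => ball x s)) [].
- by move=> x _; exact: ball_open.
- by move=> x Cx; exists x => //; exact: ballxx.
move=> S SC cov.
have [D [uD DS sepD covD]] := @separated_subseq (s *+ 2) (finmap.enum_fset S) (mulrn_wgt0 2 s0).
exists D; split => //.
  by move=> x /DS xS; have := SC x xS; rewrite inE.
move=> x /cov[y /= yS yx]; have [w wD yw] := covD y yS; exists w => //.
rewrite mulrSr; apply: ball_triangle yx.
by rewrite -ball_normE/= distrC.
Qed.

Lemma lebesgue_rV_cover C s (D : seq 'rV[R]_n) : measurable C -> 0 < s ->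
  (forall x, C x -> exists2 y, y \in D & ball y s x) ->
  (mu C <= ((size D)%:R * (s *+ 2) ^+ n)%:E)%E.
Proof.
move=> mC s0 H.
have mD (E : seq 'rV[R]_n) : measurable (\big[setU/set0]_(y <- E) ball y s).
  by apply: bigsetU_measurable => y _; exact: measurable_ball_rV.
apply: (@le_trans _ _ (mu (\big[setU/set0]_(y <- D) ball y s))).
  apply: le_measure; rewrite ?inE// => x /H[y yD yx].
  by rewrite -bigcup_seq; exists y.
elim: D {H} => [|y D IH]; first by rewrite big_nil measure0 mul0r.
rewrite big_cons; apply: le_trans (measureU2 _ _ _) _ => //.
  exact: measurable_ball_rV.
rewrite /= -natr1 mulrDl mul1r addrC EFinD; apply: leeD => //.
by rewrite [leLHS]lebesgue_rV_ball.
Qed.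

Lemma sum_integral_disjoint (I : choiceType) (D : seq I) (B : I -> set 'rV[R]_n)
    (E : set 'rV[R]_n) (f : 'rV[R]_n -> \bar R) :
  uniq D -> measurable E -> (forall i, measurable (B i)) ->
  (forall i, i \in D -> B i `<=` E) ->
  (forall i j, i \in D -> j \in D -> i != j -> B i `&` B j = set0) ->
  measurable_fun E f -> (forall x, E x -> 0 <= f x)%E ->
  (\sum_(i <- D) \int[mu]_(x in B i) f x <= \int[mu]_(x in E) f x)%E.
Proof.
move=> uD mE mB BE tB mf f0.
have UE : \big[setU/set0]_(i <- D) B i `<=` E.
  by rewrite -bigcup_seq => x [i /= iD]; exact: BE.
have mU : measurable (\big[setU/set0]_(i <- D) B i) by exact: bigsetU_measurable.
rewrite -ge0_integral_bigsetU//.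
- exact: ge0_subset_integral.
- by apply/trivIsetP => i j /= iD jD ij; exact: tB.
- exact: measurable_funS mf.
- by move=> x /UE; exact: f0.
Qed.

End separated_cover.

(** * Geometry of a regular element *)

Section polytope_geometry.
Context {R : realType} {n : nat}.
Implicit Types (x y z : 'rV[R]_n) (K : set 'rV[R]_n).

Lemma enorm_ge0 x : 0 <= enorm x.
Proof. exact: sqrtr_ge0. Qed.

Lemma enormZ (a : R) x : enorm (a *: x) = `|a| * enorm x.
Proof.
rewrite /enorm -sqrtr_sqr -sqrtrM ?sqr_ge0//; congr Num.sqrt.
by rewrite /dot mulr_sumr; apply: eq_bigr => i _; rewrite !mxE expr2 mulrACA.
Qed.

Lemma le_norm_enorm x : `|x| <= enorm x.
Proof.
apply/norm_rVP; first exact: enorm_ge0.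
move=> i; rewrite -sqrtr_sqr ler_wsqrtr// /dot (bigD1 i)//= -expr2 lerDl.
by apply: sumr_ge0 => j _; rewrite -expr2 sqr_ge0.
Qed.

Lemma le_enorm_norm x : (0 < n)%N -> enorm x <= n%:R * `|x|.
Proof.
move=> n0; rewrite -[leRHS]ger0_norm ?mulr_ge0// -sqrtr_sqr ler_wsqrtr//.
apply: (@le_trans _ _ (\sum_(i < n) `|x| ^+ 2)).
  apply: ler_sum => i _; rewrite -expr2 -real_normK ?num_real//.
  by rewrite lerXn2r ?nnegrE//; exact: ler_norm_coord.
rewrite sumr_const card_ord exprMn -[leLHS]mulr_natl ler_wpM2r ?sqr_ge0//.
by rewrite -natrX ler_nat expnS expn1 leq_pmulr.
Qed.

Lemma polytope_convex K x y (s : R) : polytope K -> K x -> K y ->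
  0 <= s -> s <= 1 -> K ((1 - s) *: x + s *: y).
Proof.
move=> [m [P ->]] [w [w0 w1] <-] [w' [w'0 w'1] <-] s0 s1.
exists ((1 - s) *: w + s *: w'); last by rewrite mulmxDl !scalemxAl.
split=> [i|].
  by rewrite !mxE addr_ge0// mulr_ge0// subr_ge0.
under eq_bigr do rewrite !mxE.
by rewrite big_split/= -!mulr_sumr w1 w'1 !mulr1 subrK.
Qed.

Lemma polytope_compact K : polytope K -> compact K.
Proof.
move=> [m [P ->]]; apply: continuous_compact.
  apply: continuous_subspaceT => w.
  have FF := nbhs_filter w; apply/cvg_ballP => e e0.
  pose c := m%:R * `|P| + 1.
  have c0 : 0 < c by rewrite ltr_wpDl// mulr_ge0.
  have : nbhs w (ball w (e / c)) := nbhsx_ballx w _ (divr_gt0 e0 c0).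
  apply: filterS => w' /(ball_rVP _ _ (divr_gt0 e0 c0)) H.
  apply/ball_rVP => // j; rewrite !mxE -sumrB.
  apply: (@le_lt_trans _ _ (\sum_(k < m) (e / c * `|P|))).
    apply: le_trans (ler_norm_sum _ _ _) _; apply: ler_sum => k _.
    rewrite -mulrBl normrM; apply: ler_pM => //; first exact/ltW/H.
    rewrite [`|P|]mx_normrE.
    exact: (@le_bigmax _ _ _ _ (fun ij : 'I_m * 'I_n => `|P ij.1 ij.2|) (k, j)).
  rewrite sumr_const card_ord -mulr_natl.
  rewrite (_ : _ * _ = e * ((m%:R * `|P|) / c)); last by ring.
  by rewrite gtr_pMr// ltr_pdivrMr// mul1r /c ltrDl.
apply: bounded_closed_compact.
  exists 1; split; first exact: num_real.
  move=> N N1 w /= [w0 w1]; rewrite (le_trans _ (ltW N1))//.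
  apply/norm_rVP => // i; rewrite ger0_norm// -w1 (bigD1 i)//= lerDl.
  exact: sumr_ge0.
rewrite (_ : mkset _ = (\bigcap_(i in [set: 'I_m]) [set w : 'rV[R]_m | 0 <= w 0 i]) `&`
   [set w : 'rV[R]_m | \sum_i w 0 i = 1]); last first.
  apply/seteqP; split => w /= [H1 H2]; split => // i.
    by move=> _; exact: H1.
  exact: (H1 i I).
apply: closedI.
  apply: closed_bigI => i _.
  rewrite (_ : mkset _ = (fun w : 'rV[R]_m => w 0 i) @^-1` [set y : R | 0 <= y]) //.
  by apply: closed_comp; [move=> w _; exact: coord_continuous|exact: closed_ge].
rewrite (_ : mkset _ = (fun w : 'rV[R]_m => \sum_i w 0 i) @^-1` [set y : R | y = 1]) //.
apply: closed_comp; last exact: closed_eq.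
by move=> w _; apply: continuous_bigsum => i; exact: coord_continuous.
Qed.

Lemma enorm_le_diam K x y : polytope K -> K x -> K y -> enorm (x - y) <= diam K.
Proof.
move=> pK Kx Ky; apply: ub_le_sup; last by exists x => //; exists y.
have [M [_ HM]] := compact_bounded (polytope_compact pK).
have KM z : K z -> `|z| <= `|M| + 1.
  by apply: HM; rewrite ltr_pwDr// ler_norm.
have [n0|n0] := posnP n.
  exists 0 => _ [a Ka [b Kb <-]]; rewrite /enorm /dot big1 ?sqrtr0// => i _.
  by have := ltn_ord i; rewrite [X in (_ < X)%N -> _]n0.
exists (n%:R * ((`|M| + 1) + (`|M| + 1))) => _ [a Ka [b Kb <-]].
apply: le_trans (le_enorm_norm _ n0) _; rewrite ler_wpM2l//.
by apply: le_trans (ler_normB _ _) _; rewrite lerD ?KM.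
Qed.

Lemma element_center K (sigma : R) : (0 < n)%N -> polytope K -> K° !=set0 ->
  0 < sigma -> diam K / inscribed_diam K < sigma ->
  0 < diam K /\ exists z e, [/\ 0 < e, eball z e `<=` K & diam K < 2 * sigma * e].
Proof.
move=> n0 pK [x0 Kx0] sigma0 reg.
have inK x e : 0 < e -> eball x e `<=` K -> e / 2 <= diam K.
  move=> e0 xK; pose y := x + (e / 2) *: delta_mx 0 (Ordinal n0).
  have E : enorm (y - x) = e / 2.
    rewrite /y addrC addKr enormZ gtr0_norm ?divr_gt0// -[RHS]mulr1; congr (_ * _).
    rewrite /enorm /dot (bigD1 (Ordinal n0))//= big1 => [|i i0].
      by rewrite !mxE !eqxx addr0 mulr1 sqrtr1.
    by rewrite !mxE (negbTE i0) mulr0.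
  rewrite -E; apply: enorm_le_diam => //; apply: xK; rewrite /eball/=.
    by rewrite E; lra.
  by rewrite subrr /enorm /dot big1 ?sqrtr0// => i _; rewrite mxE mul0r.
have /nbhs_ballP[r /= r0 rK] : nbhs x0 K by [].
have rK' : eball x0 r `<=` K.
  move=> y yr; apply: rK; rewrite -ball_normE/= distrC.
  exact: le_lt_trans (le_norm_enorm _) yr.
have d0 : 0 < diam K by apply: lt_le_trans (inK _ _ r0 rK'); rewrite divr_gt0.
split => //; pose S := [set e : R | 0 < e /\ exists x, eball x e `<=` K].
have ubS : has_ubound [set 2 * e | e in S].
  by exists (4 * diam K) => _ [e [e0 [x xK]] <-]; have := inK _ _ e0 xK; lra.
have i0 : 0 < inscribed_diam K.
  apply: (@lt_le_trans _ _ (2 * r)); first by rewrite mulr_gt0.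
  by apply: ub_le_sup => //; exists r => //; split => //; exists x0.
have : diam K / sigma < inscribed_diam K.
  by rewrite ltr_pdivrMr// mulrC -ltr_pdivrMr.
move=> /sup_gt[]; first by exists (2 * r), r => //; split => //; exists x0.
move=> _ [e [e0 [x xK]] <-]; rewrite ltr_pdivrMr// => he.
by exists x, e; split => //; rewrite mulrAC.
Qed.

Lemma element_cube K (sigma l : R) x : (0 < n)%N -> polytope K -> K° !=set0 ->
  0 < sigma -> diam K / inscribed_diam K < sigma -> K x -> 0 < l -> l <= diam K ->
  exists2 z, ball z ((2 * sigma * n%:R)^-1 * l) `<=` K & `|z - x| <= l.
Proof.
move=> n0 pK K0 sigma0 reg Kx l0 ld.
have [d0 [z [e [e0 zK de]]]] := element_center n0 pK K0 sigma0 reg.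
have Kz : K z.
  by apply: zK; rewrite /eball/= subrr /enorm /dot big1 ?sqrtr0// => i _; rewrite mxE mul0r.
pose s := l / diam K.
have s0 : 0 < s by rewrite divr_gt0.
have s1 : s <= 1 by rewrite ler_pdivrMr// mul1r.
exists ((1 - s) *: x + s *: z); last first.
  rewrite scalerBl scale1r addrAC [x - _]addrC addrK addrC -scalerBr normrZ gtr0_norm//.
  rewrite -[leRHS](@divfK _ (diam K)) ?gt_eqF// ler_pM2l//.
  by apply: le_trans (le_norm_enorm _) _; exact: enorm_le_diam.
set z' := _ + _ => y yz'.
have -> : y = (1 - s) *: x + s *: (z + s^-1 *: (y - z')).
  rewrite scalerDr scalerA divff ?gt_eqF// scale1r addrA.
  by rewrite -/z' addrC subrK.
apply: polytope_convex => //; last exact: ltW.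
apply: zK; rewrite /eball/= addrC addKr enormZ gtr0_norm ?invr_gt0//.
rewrite ltr_pdivrMl//.
apply: le_lt_trans (le_enorm_norm _ n0) _.
have nR : 0 < n%:R :> R by rewrite ltr0n.
move: yz'; rewrite -ball_normE/= distrC => yz'.
apply: (@lt_le_trans _ _ (n%:R * ((2 * sigma * n%:R)^-1 * l))).
  by rewrite ltr_pM2l.
rewrite /s invfM mulrA mulrCA divff ?gt_eqF// mulr1.
rewrite -[_ / _ * e]mulrA [l * _]mulrC ler_pM2r// ler_pdivlMl//.
rewrite ler_pdivrMr ?mulr_gt0// mulrC; exact: ltW.
Qed.

End polytope_geometry.

(** * The moment bound on one element *)

Section element_bound.
Context {R : realType} {n r : nat}.
Local Notation mu := (lebesgue_rV R n).
Variables (sigma : R) (K G Q C : set 'rV[R]_n) (f u v g : 'rV[R]_n -> R).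
Variables (t eta M : R) (a b gam : 'I_n -> nat).
Let theta := (2 * sigma * n%:R)^-1.
Hypotheses (n0 : (0 < n)%N) (sigma0 : 0 < sigma) (pK : polytope K)
  (K0 : K° !=set0) (regK : diam K / inscribed_diam K < sigma)
  (oG : open G) (KG : K° `<=` G) (cQ : compact Q) (cC : compact C)
  (cf : continuous f) (t0 : 0 < t) (eta0 : 0 < eta)
  (fC : forall x, C x -> t <= `|f x|)
  (CQ : forall x y, C x -> `|x - y| < (1 + theta) * eta ->
    Q y /\ `|f y - f x| <= t / 2)
  (ua : exists ga, is_weak_derivative G a u ga)
  (ug : is_weak_derivative G gam u g)
  (vP : exists2 P, polynomial_lt r P & forall x, K° x -> v x = P x)
  (v0 : forall x, K° x -> mpartial gam v x = 0)
  (gamE : forall i, gam i = (a i + b i)%N) (br : (midx_order b <= r)%N)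
  (M1 : 1 <= M)
  (bM : forall k t, (k <= r)%N -> `|derive1n k (@bump R) t| <= M).

Let E := K°.
Let w := weakD E a (u \- v).
Let l := Num.min (diam K) eta.

Let theta0 : 0 < theta.
Proof. by rewrite invr_gt0 !mulr_gt0// ltr0n. Qed.

Let oE : open E. Proof. exact: open_interior. Qed.

Let l0 : 0 < l.
Proof. by rewrite lt_min eta0 andbT; have [] := element_center n0 pK K0 sigma0 regK. Qed.

Let wE : is_weak_derivative E a (u \- v) w.
Proof. by have [] := weakD_error_moment oG oE KG ua ug vP v0 gamE. Qed.

Let mw : measurable_fun E w. Proof. by have [_ []] := wE. Qed.

Lemma cube_moment_le z rho : 0 < rho -> ball z rho `<=` E ->
  (`|\int[mu]_(x in E) (g x * cube_bump z rho (fun=> 0%N) x)%:E| <=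
   \int[mu]_(x in ball z rho)
     ((rho^-1 ^+ midx_order b * M ^+ n)%:E * `|w x|%:E))%E.
Proof.
move=> rho0 zE; have mE := open_measurable_rV oE.
have [_ ->] := weakD_error_moment oG oE KG ua ug vP v0 gamE; last first.
- exact: test_function_cube_bump.
- exact: smooth_cube_bump_factor.
rewrite -/(cube_bump z rho b) -/w.
have mphi D : measurable_fun D (cube_bump z rho b).
  apply: measurable_funTS; apply: continuous_measurable_rV.
  by apply: continuous_tensors; exact: smooth_cube_bump_factor.
have mb : measurable (ball z rho : set 'rV[R]_n) by exact: measurable_ball_rV.
have mwb : measurable_fun (ball z rho) w by exact: measurable_funS mw.
apply: le_trans (le_abse_integral _ _ _) _ => //.
  by apply/measurable_EFinP; exact: measurable_funM.
rewrite (@integral_support _ _ (ball z rho) E)//; last first.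
  move=> x Ex zx; rewrite cube_bump_eq0 ?mulr0 ?abse0// ltNge; apply/negP => xz.
  by apply: zx; have [_] := cube_bump_support z rho0; apply.
apply: ge0_le_integral => //.
- apply/measurable_EFinP; apply: measurableT_comp => //.
  exact: measurable_funM.
- by apply: measurable_funeM; apply/measurable_EFinP; exact: measurableT_comp.
- move=> x zx; rewrite -EFinM lee_fin normrM mulrC ler_wpM2r//.
  exact: cube_bump_bound br.
Qed.

Lemma element_bound :
  ((t / 2 * (flat 0 4^-1 ^+ 2 * theta / (12 * (1 + theta))) ^+ n)%:E * mu (C `&` K) <=
   \int[mu]_(x in E `&` Q) `|g x - f x|%:E +
   ((theta * l)^-1 ^+ midx_order b * M ^+ n)%:E * \int[mu]_(x in E) `|w x|%:E)%E.
Proof.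
have mE := open_measurable_rV oE.
have mQ := compact_measurable_rV cQ.
have cK := polytope_compact pK.
have clK : closed K by exact: compact_closed.
have cCK : compact (C `&` K).
  by apply: (@subclosed_compact _ (C `&` K) C) => //; apply: closedI => //; exact: compact_closed.
pose s := (1 + theta) * l.
have s0 : 0 < s by rewrite mulr_gt0// ltr_wpDl.
pose rho := theta * l.
have rho0 : 0 < rho by rewrite mulr_gt0.
have [D [uD DC sepD covD]] := separated_cover cCK s0.
have ld : l <= diam K by rewrite /l ge_min lexx.
have le : l <= eta by rewrite /l ge_min lexx orbT.
have /choice[zf Hz] : forall x, exists z, K x -> ball z rho `<=` E /\ `|z - x| <= l.
  move=> x; case: (pselect (K x)) => Kx; last by exists 0.
  have [z zK zx] := element_cube n0 pK K0 sigma0 regK Kx l0 ld.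
  exists z => _; split => //; rewrite /E -open_subsetE//; exact: ball_open.
have near_x x y : K x -> ball (zf x) rho y -> `|x - y| < s.
  move=> Kx; rewrite -ball_normE/= => zy; have [_ zx] := Hz x Kx.
  rewrite -(subrKA (zf x)) (le_lt_trans (ler_normD _ _))//.
  rewrite /s mulrDl mul1r; apply: ler_ltD => //.
  by rewrite distrC.
have mg : measurable_fun E g.
  have [_ [mg _] _] := ug; apply: measurable_funS mg => //.
  exact: open_measurable_rV.
have mF B : measurable B -> B `<=` E -> measurable_fun B (fun x => `|g x - f x|%:E).
  move=> mB BE; apply/measurable_EFinP; apply: measurableT_comp => //.
  apply: measurable_funB; first exact: measurable_funS mg.
  by apply: measurable_funTS; exact: continuous_measurable_rV.
have lg : locally_Lebesgue_integrable E g.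
  have [_ lg _] := ug.
  by apply: locally_Lebesgue_integrableS lg => //; exact: open_measurable_rV.
set A := (rho^-1 ^+ midx_order b * M ^+ n).
have A0 : 0 <= A by rewrite mulr_ge0 ?exprn_ge0 ?invr_ge0 ?ltW// (lt_le_trans _ M1).
apply: (@le_trans _ _ (\sum_(x <- D) (t / 2 * (flat 0 4^-1 ^+ 2 * (rho / 2)) ^+ n)%:E)%E).
  set k := (t / 2 * _); have k0 : 0 <= k.
    have th0 : 0 <= theta by exact: ltW.
    apply: mulr_ge0; first by rewrite divr_ge0// ltW.
    apply: exprn_ge0; apply: divr_ge0; last by rewrite mulr_ge0// addr_ge0.
    by rewrite mulr_ge0// exprn_ge0// flat_ge0.
  have := lebesgue_rV_cover (compact_measurable_rV cCK) (mulrn_wgt0 3 s0) covD.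
  move=> /(lee_wpmul2l (_ : (0 <= k%:E)%E)) => /(_ _)/le_trans; apply.
    by rewrite lee_fin.
  rewrite -EFinM sumEFin lee_fin big_const_seq count_predT iter_addr_0 -[leRHS]mulr_natl.
  rewrite mulrCA ler_wpM2l//.
  rewrite (_ : k * _ = t / 2 * ((flat 0 4^-1 ^+ 2 * theta / (12 * (1 + theta))) *
    (s *+ 3 *+ 2)) ^+ n); last by rewrite exprMn mulrA.
  rewrite le_eqVlt; apply/orP; left; apply/eqP; congr (_ * _ ^+ _).
  rewrite /s /rho; field.
  by rewrite gt_eqF// ltr_wpDl// ltW.
apply: (@le_trans _ _ (\sum_(x <- D) (\int[mu]_(y in ball (zf x) rho) `|g y - f y|%:E +
   A%:E * \int[mu]_(y in ball (zf x) rho) `|w y|%:E))%E).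
  rewrite big_seq [leRHS]big_seq; apply: lee_sum => x xD.
  have [Cx Kx] := DC x xD; have [zE zx] := Hz x Kx.
  pose sg : R := if 0 <= f x then 1 else -1.
  have sg1 : sg = 1 \/ sg = -1 by rewrite /sg; case: ifP; [left|right].
  have fy y : ball (zf x) rho y -> t / 2 <= sg * f y.
    move=> zy; have [|_] := CQ (y := y) Cx.
      by apply: lt_le_trans (near_x _ _ Kx zy) _; rewrite /s ler_pM2l// ltr_wpDl.
    have := fC Cx; rewrite /sg ler_norml; case: ifPn => [fx|].
      by rewrite ger0_norm//; lra.
    by rewrite -ltNge => fx; rewrite ltr0_norm//; lra.
  have t20 : 0 <= t / 2 by rewrite divr_ge0 ?ltW.
  apply: le_trans (cube_bump_moment rho0 oE zE lg cf sg1 t20 fy) _.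
  rewrite addeC leeD2l//; apply: le_trans (cube_moment_le rho0 zE) _.
  rewrite ge0_integralZl//.
  - exact: measurable_ball_rV.
  - apply/measurable_EFinP; apply: measurableT_comp => //; exact: measurable_funS mw.
rewrite big_split/=; apply: leeD.
  apply: (sum_integral_disjoint uD) => //.
  - exact: measurableI.
  - by move=> x; exact: measurable_ball_rV.
  - move=> x /DC[Cx Kx] y zy; have [zE _] := Hz x Kx; split; first exact: zE.
    have [] // := CQ (y := y) Cx.
    by apply: lt_le_trans (near_x _ _ Kx zy) _; rewrite /s ler_pM2l// ltr_wpDl.
  - move=> x y xD yD xy; apply/seteqP; split => // q [xq yq].
    have := sepD x y xD yD xy; rewrite leNgt => /negP; apply.
    rewrite -(subrKA q) (le_lt_trans (ler_normD _ _))// mulr2n ltrD//.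
      by apply: near_x => //; have [] := DC x xD.
    by rewrite distrC; apply: near_x => //; have [] := DC y yD.
  - by apply: mF; [exact: measurableI|exact: subIsetl].
rewrite -ge0_sume_distrr; last by move=> x _; exact: integral_ge0.
rewrite lee_wpmul2l ?lee_fin//.
apply: (sum_integral_disjoint uD) => //.
- by move=> x; exact: measurable_ball_rV.
- by move=> x /DC[Cx Kx]; have [] := Hz x Kx.
- move=> x y xD yD xy; apply/seteqP; split => // q [xq yq].
  have := sepD x y xD yD xy; rewrite leNgt => /negP; apply.
  rewrite -(subrKA q) (le_lt_trans (ler_normD _ _))// mulr2n ltrD//.
    by apply: near_x => //; have [] := DC x xD.
  by rewrite distrC; apply: near_x => //; have [] := DC y yD.
- by apply/measurable_EFinP; exact: measurableT_comp.
Qed.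

End element_bound.

Section estimates.
Context {R : realType} {n : nat}.
Local Notation mu := (lebesgue_rV R n).
Implicit Types (f g w : 'rV[R]_n -> R) (E G Q : set 'rV[R]_n).

Lemma compact_uniform_continuity f Q (e : R) : compact Q -> continuous f -> 0 < e ->
  exists2 eta : R, 0 < eta &
    forall x y, Q x -> `|x - y| < eta -> `|f y - f x| <= e.
Proof.
move=> /compact_near_coveringP cQ cf e0.
have H := cQ R 0^'+ (fun i x => forall y, `|x - y| < i -> `|f y - f x| <= e) _.
have {}H : \forall i \near 0^'+, Q `<=` (fun x => forall y, `|x - y| < i -> `|f y - f x| <= e).
  apply: H => x Qx.
  have e20 : 0 < e / 2 by rewrite divr_gt0.
  have FF := nbhs_filter x.
  have /nbhs_ballP[s /= s0 sP] : \forall y \near x, `|f x - f y| < e / 2.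
    exact: ((@cvgrPdist_lt _ R^o _ _ (nbhs_filter x) f (f x)).1 (cf x)).
  have s20 : 0 < s / 2 by rewrite divr_gt0.
  exists (ball x (s / 2), [set i | i < s / 2]) => /=.
    split; first exact: nbhsx_ballx.
    exact: nbhs_right_lt.
  move=> [x' i] /= [xx' i2] y x'y.
  have h1 := sP x' (le_ball (ltW (_ : s / 2 < s)) xx').
  have h2 := sP y.
  rewrite -(subrKA (f x)) (splitr e) (le_trans (ler_normD _ _))//.
  rewrite lerD//.
    rewrite distrC ltW// h2// [s]splitr; apply: ball_triangle xx' _.
    by rewrite -ball_normE/=; exact: lt_trans i2.
  by rewrite ltW// h1//; lra.
have [i i0 Hi] : exists2 i : R, 0 < i &
    Q `<=` (fun x => forall y, `|x - y| < i -> `|f y - f x| <= e).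
  near (0 : R)^'+ => i; exists i => //; near: i => //.
by exists i => // x y Qx; exact: Hi.
Unshelve. all: by end_near. Qed.

Lemma continuous_dist (y : 'rV[R]_n) : continuous (fun x : 'rV[R]_n => `|x - y|).
Proof.
move=> x; apply: (@continuous_comp _ _ _ (fun x : 'rV[R]_n => x - y) Num.norm).
  by apply: continuousB; [exact: cvg_id|exact: cst_continuous].
exact: norm_continuous.
Qed.

Definition exhaustion G (k : nat) : set 'rV[R]_n :=
  [set x | `|x| <= k.+1%:R] `&`
  \bigcap_(y in ~` G) [set x | k.+1%:R^-1 <= `|x - y|].

Lemma exhaustion_compact G k : compact (exhaustion G k).
Proof.
apply: bounded_closed_compact.
  exists k.+1%:R; split; first exact: num_real.
  by move=> N kN x [/= xk _]; rewrite (le_trans xk)// ltW.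
apply: closedI.
  rewrite (_ : mkset _ = Num.norm @^-1` [set y : R | y <= k.+1%:R]) //.
  by apply: closed_comp; [move=> x _; exact: norm_continuous|exact: closed_le].
apply: closed_bigI => y _.
rewrite (_ : mkset _ = (fun x : 'rV[R]_n => `|x - y|) @^-1` [set s : R | k.+1%:R^-1 <= s]) //.
by apply: closed_comp; [move=> x _; exact: continuous_dist|exact: closed_ge].
Qed.

Lemma exhaustion_sub G k : exhaustion G k `<=` G.
Proof.
move=> x [_ xG]; apply: contrapT => Gx; have := xG x Gx.
by rewrite /= subrr normr0 leNgt invr_gt0 ltr0n.
Qed.

Lemma exhaustion_near G k x y : exhaustion G k x ->
  `|x - y| < (2 * k.+1%:R)^-1 -> exhaustion G (2 * k).+1 y.
Proof.
have k0 : 0 < k.+1%:R :> R by rewrite ltr0n.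
have E : (2 * k).+2%:R = 2 * k.+1%:R :> R by rewrite -natrM; congr _%:R; lia.
move=> [/= xk xG] xy; split => /=.
  rewrite -[y](subrK x) E (le_trans (ler_normD _ _))// distrC.
  have : (2 * k.+1%:R)^-1 <= 1 :> R by rewrite invf_le1 ?mulr_gt0// -natrM ler1n.
  have : 1 <= k.+1%:R :> R by rewrite ler1n.
  by move: (_^-1) xy xk => i; lra.
move=> z Gz; rewrite /= E; have := xG z Gz => /= xz.
have : `|x - z| <= `|x - y| + `|y - z| by rewrite -[x - z](subrKA y) ler_normD.
have : k.+1%:R^-1 = (2 * k.+1%:R)^-1 *+ 2 :> R.
  by rewrite mulr2n; field; rewrite gt_eqF.
by move: (_^-1) (_^-1) xy xz => i j; lra.
Qed.

Lemma bigcup_exhaustion G : open G -> G = \bigcup_k exhaustion G k.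
Proof.
move=> oG; apply/seteqP; split => x; last by move=> [k _ /exhaustion_sub].
move=> Gx; have /nbhs_ballP[r /= r0 rG] : nbhs x G by exact: open_nbhs_nbhs.
have [k kr] := ltr_add_invr r0; rewrite add0r in kr.
have [l xl] : exists l : nat, `|x| <= l%:R.
  by exists (Num.truncn `|x|).+1; rewrite ltW// truncnS_gt.
exists (maxn k l) => //; split => /=.
  by rewrite (le_trans xl)// ler_nat leqW// leq_maxr.
move=> y Gy /=; rewrite leNgt; apply/negP => xy; apply: Gy; apply: rG.
rewrite -ball_normE/= (lt_trans xy)// (le_lt_trans _ kr)//.
by rewrite lef_pV2 ?posrE// ler_nat ltnS leq_maxl.
Qed.

Lemma exhaustion_nd G k l : (k <= l)%N -> exhaustion G k `<=` exhaustion G l.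
Proof.
move=> kl x [/= xk xG]; split => /=; first by rewrite (le_trans xk)// ler_nat ltnS.
move=> y Gy /=; apply: le_trans (xG y Gy).
by rewrite lef_pV2 ?posrE// ler_nat ltnS.
Qed.

Lemma Lp_norm_gt0_exhaustion G (p : R) g : open G -> measurable_fun G g -> 0 < p ->
  (0 < Lp_norm G p%:E g)%E ->
  exists k, exists2 t : R, 0 < t &
    (0 < mu (exhaustion G k `&` [set x | (2 * t < `|g x|)%R]))%E.
Proof.
move=> oG mg p0 Ng; apply: contrapT => H.
have mG := open_measurable_rV oG.
pose A k := exhaustion G k `&` [set x | 2 * k.+1%:R^-1 < `|g x|].
have mA k : measurable (A k).
  have mE := compact_measurable_rV (@exhaustion_compact G k).
  have mgE : measurable_fun (exhaustion G k) (fun x => `|g x|).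
    by apply: measurableT_comp => //; apply: measurable_funS mg => //; exact: exhaustion_sub.
  have := mgE mE [set y | 2 * k.+1%:R^-1 < y] _.
  apply; rewrite (_ : [set y | _] = `]2 * k.+1%:R^-1, +oo[%classic); first exact: measurable_itv.
  by apply/seteqP; split => y /=; rewrite in_itv/= andbT.
have A0 k : mu (A k) = 0%E.
  apply/eqP; rewrite eq_le measure_ge0 andbT leNgt; apply/negP => muA; apply: H.
  by exists k, k.+1%:R^-1; rewrite ?invr_gt0.
pose N := \bigcup_k A k.
have mN : measurable N by exact: bigcup_measurable.
have N0 : mu N = 0%E.
  apply/negligibleP => //; apply: negligible_bigcup => k.
  by exists (A k); split; [exact: mA|exact: A0|].
move: Ng; rewrite /Lp_norm unlock.
rewrite (_ : (\int[mu]_x _)%E = 0%E) ?poweR0r ?ltxx// ?invr_neq0 ?gt_eqF//.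
rewrite (@integral_support _ _ N)//; last first.
  move=> x _ Nx; rewrite /patch; case: ifPn => [/set_mem Gx|_]; last first.
    by rewrite abse0 poweR0r// gt_eqF.
  have [gx|gx] := eqVneq (g x) 0.
    by rewrite /= gx normr0 powR0// gt_eqF.
  exfalso; apply: Nx; have : G x by [].
  rewrite (bigcup_exhaustion oG) => -[k _ kx].
  have gx0 : 0 < `|g x| / 2 by rewrite divr_gt0// normr_gt0.
  have [l lg] := ltr_add_invr gx0; rewrite add0r in lg.
  exists (maxn k l) => //; split; first exact: exhaustion_nd (leq_maxl _ _) _ kx.
  rewrite /= mulrC -ltr_pdivlMr//; apply: le_lt_trans lg.
  by rewrite lef_pV2 ?posrE// ler_nat ltnS leq_maxr.
apply: null_set_integral => //; apply: measurable_funTS.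
apply: (measurableT_comp (measurable_poweR p)); apply: measurableT_comp => //.
by apply: (measurable_restrictT _ mG).1; exact/measurable_EFinP.
Qed.

Lemma hoelder_set E (V : R) w (q : \bar R) : measurable E -> 0 <= V ->
  (mu E <= V%:E)%E -> (0 < mu setT)%E -> measurable_fun E w -> (1 <= q)%E ->
  (\int[mu]_(x in E) `|w x|%:E <= (V `^ (1 - fine (q^-1)%E))%:E * Lp_norm E q w)%E.
Proof.
move=> mE V0 EV T0 mw q1.
have mwE : measurable_fun setT (w \_ E) by exact: (measurable_restrictT w mE).1.
have L1 : (\int[mu]_(x in E) `|w x|%:E = 'N[mu]_1[EFin \o (w \_ E)])%E.
  rewrite Lnorm1 [LHS]integral_mkcond; apply: eq_integral => x _.
  by rewrite /= /patch; case: ifPn => //=; rewrite normr0.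
rewrite /Lp_norm restrict_EFin.
case: q q1 => [q| |] //; last first.
  move=> _; rewrite invey/= subr0 powRr1// unlock T0.
  set S := ess_sup _ _.
  have S0 : (0 <= S)%E by apply: ess_sup_gee => //; apply: aeW => x; exact: abse_ge0.
  apply: (@le_trans _ _ (S * mu E)%E); last by rewrite muleC lee_wpmul2r.
  have := @integral_le_bound _ _ _ mu E (EFin \o w) S mE _ S0.
  apply; first exact/measurable_EFinP.
  have := ess_sup_ge mu (abse \o (EFin \o (w \_ E))).
  by apply: filterS => x + Ex; rewrite /= /patch mem_set.
rewrite lee_fin => q1; have q0 : 0 < q by exact: lt_le_trans q1.
rewrite inver gt_eqF//=.
have [->|qn1] := eqVneq q 1; first by rewrite invr1 subrr powRr0 mul1e L1.
have q1' : 1 < q by rewrite lt_neqAle eq_sym qn1.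
pose q' := (1 - q^-1)^-1.
have q'0 : 0 < q' by rewrite invr_gt0 subr_gt0 invf_lt1.
have qq' : q^-1 + q'^-1 = 1 by rewrite /q' invrK addrC subrK.
have mI : measurable_fun setT (\1_E : 'rV[R]_n -> R) by exact: measurable_indic.
have := @hoelder _ _ _ mu (w \_ E) (\1_E) q q' mwE mI q0 q'0 qq'.
rewrite L1 muleC (_ : (w \_ E \* \1_E)%R = w \_ E); last first.
  apply/funext => x /=; rewrite /patch indicE; case: ifPn => xE; first by rewrite mulr1.
  by rewrite mul0r.
move=> /le_trans; apply; apply: lee_wpmul2r; first exact: Lnorm_ge0.
rewrite unlock (_ : (\int[mu]_x _)%E = mu E); last first.
  rewrite -[in RHS](setIT E) -(integral_indic mu measurableT mE).
  apply: eq_integral => x _; rewrite /= indicE.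
  by case: (_ \in _); rewrite /= ?normr1 ?powR1 ?normr0 ?powR0// gt_eqF.
rewrite (_ : (1 - q^-1) = q'^-1); last by rewrite /q' invrK.
rewrite -poweR_EFin; apply: gt0_ler_poweR => //.
- by rewrite invr_ge0 ltW.
- by rewrite in_itv/= measure_ge0 leey.
- by rewrite in_itv/= lee_fin V0 leey.
Qed.

Lemma young_le (p h B tau : R) (k : R) : 1 <= p -> 0 < h -> 0 <= B -> 0 < tau ->
  h `^ (k * (1 - p^-1)) * B <= tau * h `^ k + tau `^ (1 - p) * B `^ p.
Proof.
move=> p1 h0 B0 tau0; have p0 : 0 < p by exact: lt_le_trans p1.
set a := h `^ (k / p).
have a0 : 0 < a by exact: powR_gt0.
have ap : a `^ p = h `^ k by rewrite /a -powRrM mulfVK ?gt_eqF.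
have aE : h `^ (k * (1 - p^-1)) = a `^ (p - 1).
  by rewrite /a -powRrM; congr (_ `^ _); field; rewrite gt_eqF.
rewrite aE -ap; have [Ba|aB] := leP B (tau * a).
  apply: (@le_trans _ _ (tau * a `^ p)).
    rewrite (_ : a `^ p = a `^ (p - 1) * a); last first.
      by rewrite -[X in _ * X]powRr1 ?ltW// -powRD ?subrK// (gt_eqF a0) implybT.
    by rewrite mulrCA ler_wpM2l ?powR_ge0.
  by rewrite lerDl mulr_ge0 ?powR_ge0.
have B0' : 0 < B by apply: lt_trans aB; rewrite mulr_gt0.
apply: (@le_trans _ _ (tau `^ (1 - p) * B `^ p)); last first.
  by rewrite lerDr mulr_ge0 ?powR_ge0// ltW.
rewrite (_ : B `^ p = B `^ (p - 1) * B); last first.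
  by rewrite -[X in _ * X]powRr1 ?ltW// -powRD ?subrK// (gt_eqF B0') implybT.
rewrite mulrA ler_wpM2r//.
rewrite -[1 - p]opprB powRN mulrC ler_pdivlMr ?powR_gt0//.
rewrite mulrC -powRM; [|exact: ltW|exact: ltW].
apply: ge0_ler_powR; rewrite ?nnegrE ?subr_ge0//; last exact: ltW.
by rewrite mulr_ge0// ltW.
Qed.

Lemma Lp_norm_le_sobolev_norm j (q : \bar R) E w a : (1 <= q)%E ->
  (midx_order a <= j)%N -> (Lp_norm E q (weakD E a w) <= sobolev_norm j q E w)%E.
Proof.
move=> q1 aj.
pose al : {ffun 'I_n -> 'I_j.+1} := [ffun i => inord (a i)].
have alE : (fun i => nat_of_ord (al i)) = a.
  apply/funext => i; rewrite ffunE inordK// ltnS (leq_trans _ aj)//.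
  by rewrite /midx_order (bigD1 i)//= leq_addr.
have N0 be : (0 <= Lp_norm E q (weakD E be w))%E by exact: Lnorm_ge0.
rewrite /sobolev_norm; case: q q1 N0 => [q| |] //.
  rewrite lee_fin => q1 N0; have q0 : 0 < q by exact: lt_le_trans q1.
  set S := (\sum_(_ | _) _)%E.
  apply: (@le_trans _ _ ((Lp_norm E q%:E (weakD E a w) `^ q) `^ q^-1)%E).
    by rewrite -poweRrM divff ?gt_eqF// poweRe1.
  have LS : (Lp_norm E q%:E (weakD E a w) `^ q <= S)%E.
    rewrite /S (bigD1 al)/=; last by rewrite alE.
    by rewrite alE leeDl// sume_ge0// => be _; exact: poweR_ge0.
  apply: gt0_ler_poweR => //.
  - by rewrite invr_ge0 ltW.
  - by rewrite in_itv/= poweR_ge0 leey.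
  - by rewrite in_itv/= leey andbT (le_trans _ LS)// poweR_ge0.
move=> _ N0; rewrite -[in leLHS]alE.
by apply: (bigmax_sup al) => //; rewrite alE.
Qed.

Lemma midx_split (gam : 'I_n -> nat) j : (j <= midx_order gam)%N ->
  exists a b, [/\ forall i, gam i = (a i + b i)%N, midx_order a = j &
    midx_order b = (midx_order gam - j)%N].
Proof.
elim: j => [_|j IH jg].
  exists (fun=> 0%N), gam; split => //; first by rewrite /midx_order big1.
  by rewrite subn0.
have [a [b [gE aj bj]]] := IH (ltnW jg).
have [i bi] : exists i, (0 < b i)%N.
  apply: contrapT => /forallNP H; move: bj; rewrite {1}/midx_order big1.
    by lia.
  by move=> i _; apply/eqP; rewrite -leqn0 leqNgt; apply/negP.
have d1 : midx_order (midx1 i) = 1%N.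
  by rewrite /midx_order /midx1 (bigD1 i)//= eqxx big1// => k /negbTE ->.
exists (fun k => a k + midx1 i k)%N, (fun k => b k - midx1 i k)%N; split.
- move=> k; rewrite gE /midx1; case: eqP => [->|_]; lia.
- by rewrite /midx_order big_split/= -!/(midx_order _) aj d1 addn1.
- have : (midx_order (fun k => b k - midx1 i k) + midx_order (midx1 i) = midx_order b)%N.
    rewrite /midx_order -big_split/=; apply: eq_bigr => k _.
    by rewrite /midx1; case: eqP => [->|_]; lia.
  by rewrite d1 bj; lia.
Qed.

End estimates.

(** * The global lower bound *)

Section lower_bound.
Context {R : realType} {n : nat}.
Local Notation mu := (lebesgue_rV R n).
Implicit Types (f g w u v : 'rV[R]_n -> R) (E G Q C K : set 'rV[R]_n).

(* [Q] is a compact neighbourhood of [C] in [G] on which [f] approximates [g]; the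
   factor [kap] leaves room for the fraction of [C] that the cubes of each element
   fill. *)
Lemma compact_core G g (p theta kap : R) : open G -> locally_Lebesgue_integrable G g ->
  0 < p -> (0 < Lp_norm G p%:E g)%E -> 0 < theta -> 0 < kap ->
  exists Q C f t eta eps0 d,
  [/\ compact Q /\ Q `<=` G, compact C /\ C `<=` G,
      continuous f /\ [/\ 0 < t, 0 < eta, 0 < eps0 & 0 < d],
      forall x, C x -> t <= `|f x| &
  [/\ forall x y, C x -> `|x - y| < (1 + theta) * eta -> Q y /\ `|f y - f x| <= t / 2,
      forall x y, C x -> `|x - y| < d -> G y &
      (\int[mu]_(x in Q) `|g x - f x|%:E + eps0%:E <= (t / 2 * kap)%:E * mu C)%E]].
Proof.
move=> oG lg p0 Ng theta0 kap0; have mG := open_measurable_rV oG.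
have [mg ig] := lg.
have [k [t t0 tk]] := Lp_norm_gt0_exhaustion oG mg p0 Ng.
pose Q0 := exhaustion G k; pose Q := exhaustion G (2 * k).+1.
have cQ0 : compact Q0 by exact: exhaustion_compact.
have cQ : compact Q by exact: exhaustion_compact.
have mQ := compact_measurable_rV cQ; have mQ0 := compact_measurable_rV cQ0.
have QG : Q `<=` G by exact: exhaustion_sub.
have Q0G : Q0 `<=` G by exact: exhaustion_sub.
have Q0Q : Q0 `<=` Q by apply: exhaustion_nd; lia.
pose d : R := (2 * k.+1%:R)^-1.
have d0 : 0 < d by rewrite invr_gt0 mulr_gt0.
have Q0d x y : Q0 x -> `|x - y| < d -> Q y by exact: exhaustion_near.
set S := _ `&` _ in tk.
have mgQ0 : measurable_fun Q0 g by exact: measurable_funS mg.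
have mS : measurable S.
  have h : measurable_fun Q0 (fun x => `|g x|) by exact: measurableT_comp.
  have := h mQ0 [set y | 2 * t < y] _.
  apply; rewrite (_ : [set y | _] = `]2 * t, +oo[%classic); first exact: measurable_itv.
  by apply/seteqP; split => y /=; rewrite in_itv/= andbT.
have Soo : (mu S < +oo)%E.
  apply: le_lt_trans (lebesgue_rV_compact cQ0); apply: le_measure; rewrite ?inE//.
  exact: subIsetl.
have [m mE] : exists m, mu S = m%:E.
  by exists (fine (mu S)); rewrite fineK// ge0_fin_numE.
have m0 : 0 < m by rewrite -lte_fin -mE.
pose a := t / 2 * kap.
have a0 : 0 < a by rewrite mulr_gt0// divr_gt0.
pose e := Num.min (t * m / 2) (a * m / 4).
have e0 : 0 < e by rewrite lt_min !divr_gt0// mulr_gt0.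
have igQ : mu.-integrable Q (EFin \o g).
  apply/integrableP; split; last exact: ig.
  by apply/measurable_EFinP; exact: measurable_funS mg.
have [f cf fg] := integrable_continuous_approx mQ (lebesgue_rV_compact cQ) igQ e0.
pose C := Q0 `&` [set x | t <= `|f x|].
have cCl : closed [set x | t <= `|f x|].
  rewrite (_ : mkset _ = (fun x => `|f x|) @^-1` [set y : R | t <= y]) //.
  apply: closed_comp; last exact: closed_ge.
  by move=> x _; apply: (@continuous_comp _ _ _ f Num.norm); [exact: cf|exact: norm_continuous].
have cC : compact C.
  have clC : closed C by apply: closedI => //; exact: compact_closed.
  by apply: (subclosed_compact clC cQ0); exact: subIsetl.
have mC := compact_measurable_rV cC.
have mh D : measurable D -> D `<=` Q -> measurable_fun D (fun x => `|g x - f x|).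
  move=> mD DQ; apply: measurableT_comp => //; apply: measurable_funB.
    by apply: measurable_funS mg => //; exact: subset_trans QG.
  by apply: measurable_funTS; exact: continuous_measurable_rV.
pose B := Q0 `&` [set x | t <= `|g x - f x|].
have mB : measurable B.
  have := mh Q0 mQ0 Q0Q mQ0 [set y | t <= y] _.
  apply; rewrite (_ : [set y | _] = `[t, +oo[%classic); first exact: measurable_itv.
  by apply/seteqP; split => y /=; rewrite in_itv/= andbT.
have SCB : S `<=` C `|` B.
  move=> x [Qx /= gx]; have [tf|ft] := leP t `|f x|; first by left; split.
  right; split => //=; have : `|g x| <= `|g x - f x| + `|f x|.
    by rewrite -[X in `|X| <= _](subrK (f x)) ler_normD.
  by lra.
have muB : (t%:E * mu B <= e%:E)%E.
  apply: le_trans fg; rewrite -integral_cst//.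
  apply: (@le_trans _ _ (\int[mu]_(x in B) `|g x - f x|%:E)%E).
    apply: ge0_le_integral => //.
    - by move=> x _; rewrite lee_fin ltW.
    - apply/measurable_EFinP; apply: mh => //; apply: subset_trans Q0Q; exact: subIsetl.
    - by move=> x [_ /= tx]; rewrite lee_fin.
  apply: ge0_subset_integral => //.
  - by apply/measurable_EFinP; exact: mh.
  - by apply: subset_trans Q0Q; exact: subIsetl.
have Coo := lebesgue_rV_compact cC.
have [c cE] : exists c, mu C = c%:E.
  by exists (fine (mu C)); rewrite fineK// ge0_fin_numE.
have Boo : (mu B < +oo)%E.
  apply: le_lt_trans (lebesgue_rV_compact cQ0); apply: le_measure; rewrite ?inE//.
  exact: subIsetl.
have [b bE] : exists b, mu B = b%:E.
  by exists (fine (mu B)); rewrite fineK// ge0_fin_numE.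
have mcb : m <= c + b.
  rewrite -lee_fin EFinD -mE -cE -bE; apply: le_trans (measureU2 _ mC mB).
  by apply: le_measure; rewrite ?inE//; exact: measurableU.
rewrite bE -EFinM lee_fin in muB.
have bm : b <= m / 2.
  rewrite -(ler_pM2l t0) (le_trans muB)// /e ge_min; apply/orP; left.
  by rewrite mulrA.
have t20 : 0 < t / 2 by rewrite divr_gt0.
have [eta1 eta10 Heta] := compact_uniform_continuity cQ0 cf t20.
have th1 : 0 < 1 + theta by rewrite addr_gt0.
exists Q, C, f, t, (Num.min eta1 d / (1 + theta)), (a * m / 4), d; split.
- by [].
- by split => //; apply: subset_trans Q0G; exact: subIsetl.
- by split => //; split => //; rewrite divr_gt0 ?mulr_gt0// lt_min eta10.
- by move=> x [].
split.
- move=> x y [Qx _]; rewrite mulrC divfK ?gt_eqF// lt_min => /andP[xy1 xy2].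
  by split; [exact: Q0d xy2|exact: Heta].
- by move=> x y [Qx _] xy; apply: QG; exact: Q0d xy.
rewrite -/a cE -EFinM; apply: le_trans (leeD2r _ fg) _.
rewrite -EFinD lee_fin.
have em : e <= a * m / 4 by rewrite /e ge_min lexx orbT.
have am : a * (m / 2) <= a * c by rewrite ler_pM2l//; lra.
by lra.
Qed.

Lemma le_measure_bigcup (S : seq (set 'rV[R]_n)) C :
  measurable C -> (forall K, K \in S -> measurable K) ->
  C `<=` \bigcup_(K in [set` S]) K ->
  (mu C <= \sum_(K <- S) mu (C `&` K))%E.
Proof.
move=> mC mS CS.
have mU (S' : seq (set 'rV[R]_n)) : {subset S' <= S} ->
    measurable (\big[setU/set0]_(K <- S') (C `&` K)).
  move=> SS; rewrite big_seq; apply: bigsetU_measurable => K /SS /mS mK.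
  exact: measurableI.
apply: (@le_trans _ _ (mu (\big[setU/set0]_(K <- S) (C `&` K)))).
  apply: le_measure; rewrite ?inE//; first exact: mU.
  by move=> x Cx; have [K KS Kx] := CS x Cx; rewrite -bigcup_seq; exists K.
have : {subset S <= S} by [].
elim: {1 3 4}S => [|K S' IH] SS; first by rewrite !big_nil measure0.
have SS' : {subset S' <= S} by move=> L LS; apply: SS; rewrite inE LS orbT.
rewrite !big_cons; apply: le_trans (measureU2 _ _ _) _.
- by apply: measurableI => //; apply: mS; apply: SS; rewrite mem_head.
- exact: mU.
- by rewrite leeD2l//; exact: IH.
Qed.

Lemma element_weight (p h tau A0 : R) (j r : nat) (q N W : \bar R) : 1 <= p -> 0 < h ->
  0 < tau -> 0 <= A0 -> (j <= r)%N -> (1 <= q)%E -> (0 <= N)%E -> (0 <= W)%E ->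
  (W <= (((4 * h) ^+ n) `^ (1 - fine (q^-1)%E))%:E * N)%E ->
  ((A0 * h^-1 ^+ (r - j))%:E * W <=
   (A0 * ((4 ^+ n) `^ (1 - fine (q^-1)%E)))%:E * ((tau * h ^+ n)%:E +
     (tau `^ (1 - p))%:E *
     ((h `^ (p * ((j%:R - r%:R) + n%:R * (p^-1 - fine (q^-1)%E))))%:E * N `^ p)))%E.
Proof.
move=> p1 h0 tau0 A00 jr q1 N0' W0 WN.
set iq := fine _ in WN *; set V4 := (4 ^+ n) `^ _.
have V40 : 0 < V4 by rewrite powR_gt0.
have p0 : 0 < p by exact: lt_le_trans p1.
have [->|A0n] := eqVneq A0 0; first by rewrite !mul0r !mul0e.
have A0p : 0 < A0 by rewrite lt_neqAle eq_sym A0n.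
case: N N0' WN => [N| |] //; last first.
  move=> _ _; rewrite poweRyr ?gt_eqF// gt0_muley ?lte_fin ?powR_gt0//.
  rewrite gt0_muley ?lte_fin ?powR_gt0// addey// gt0_muley ?leey// lte_fin.
  exact: mulr_gt0.
rewrite lee_fin => N0' WN.
have WV : (W <= (V4 * (h `^ (n%:R * (1 - iq)) * N))%:E)%E.
  apply: le_trans WN _; rewrite -EFinM lee_fin mulrA ler_wpM2r//.
  rewrite exprMn powRM; [|exact: exprn_ge0|by apply: exprn_ge0; exact: ltW].
  rewrite /V4.
  by rewrite -(powR_mulrn n (ltW h0)) -powRrM.
have hr : 0 <= A0 * h^-1 ^+ (r - j) by rewrite mulr_ge0// exprn_ge0// invr_ge0 ltW.
apply: (@le_trans _ _ ((A0 * h^-1 ^+ (r - j))%:E * (V4 * (h `^ (n%:R * (1 - iq)) * N))%:E)%E).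
  by rewrite lee_wpmul2l// lee_fin.
rewrite poweR_EFin -!EFinM lee_fin.
set k := j%:R - r%:R; set ex := k + n%:R * (p^-1 - iq).
rewrite (_ : A0 * h^-1 ^+ (r - j) * (V4 * (h `^ (n%:R * (1 - iq)) * N)) =
   A0 * V4 * (h `^ (n%:R * (1 - p^-1)) * (h `^ ex * N))); last first.
  have -> : h^-1 ^+ (r - j) = h `^ k.
    rewrite exprVn -powR_mulrn ?ltW// -powRN natrB// opprB//.
  rewrite -!mulrA; congr (_ * _); rewrite mulrCA; congr (_ * _).
  rewrite !mulrA; congr (_ * _); rewrite -!powRD ?(gt_eqF h0) ?implybT//.
  by congr (_ `^ _); rewrite /ex; ring.
apply: ler_wpM2l; first by rewrite mulr_ge0// ltW.
have := @young_le R p h (h `^ ex * N) tau n%:R p1 h0 _ tau0.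
move=> /(_ (mulr_ge0 (powR_ge0 _ _) N0'))/le_trans; apply.
rewrite (powR_mulrn n (ltW h0)) lerD2l powRM ?powR_ge0//.
by rewrite -powRrM [ex * p]mulrC.
Qed.

Lemma error_lower_bound (p eps c1 Mh S : R) : 1 <= p -> 0 < eps -> 0 < c1 -> 0 < Mh ->
  (forall tau, 0 < tau -> eps <= c1 * (tau * Mh + tau `^ (1 - p) * S)) ->
  ((eps / (2 * c1)) * (eps / (2 * c1 * Mh)) `^ (p - 1)) <= S.
Proof.
move=> p1 e0 c0 M0 H; set tau := eps / (2 * c1 * Mh).
have tau0 : 0 < tau by rewrite divr_gt0// !mulr_gt0.
have := H _ tau0; rewrite mulrDr.
have -> : c1 * (tau * Mh) = eps / 2.
  by rewrite /tau; field; rewrite !gt_eqF.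
rewrite -[1 - p]opprB powRN => h.
have P0 : 0 < tau `^ (p - 1) by rewrite powR_gt0.
have : eps / 2 <= c1 * ((tau `^ (p - 1))^-1 * S) by lra.
rewrite -ler_pdivrMl// -ler_pdivrMl ?invr_gt0// invrK.
by apply: le_trans; rewrite le_eqVlt; apply/orP; left; apply/eqP; field; rewrite gt_eqF.
Qed.

End lower_bound.

Section assembly.
Context {R : realType}.

Lemma bounded_closure n (A : set 'rV[R]_n) : bounded_set A ->
  exists2 B : R, 0 < B & forall x, closure A x -> `|x| <= B.
Proof.
move=> [M [_ HM]]; exists (`|M| + 1); first by rewrite ltr_wpDl.
have cl : closed [set x : 'rV[R]_n | `|x| <= `|M| + 1].
  by apply: compact_closed; [exact: norm_hausdorff|exact: closed_ball_compact].
move=> x; rewrite closureE => /(_ _ (conj cl _)); apply.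
by move=> y Ay; apply: (HM (`|M| + 1)) => //; rewrite ltr_pwDr// ler_norm.
Qed.

Lemma lebesgue_rV_gt0 n : (0 < lebesgue_rV R n setT)%E.
Proof.
apply: (@lt_le_trans _ _ (lebesgue_rV R n (ball 0 1))).
  by rewrite lebesgue_rV_ball// lte_fin exprn_gt0.
by apply: le_measure; rewrite ?inE//; exact: measurable_ball_rV.
Qed.

Lemma lebesgue_rV_element n (K : set 'rV[R]_n) : polytope K -> K° !=set0 ->
  0 < diam K -> (lebesgue_rV R n K° <= ((4 * diam K) ^+ n)%:E)%E.
Proof.
move=> pK [x Kx] h0; have Kx' := interior_subset Kx.
have h20 : 0 < 2 * diam K by rewrite mulr_gt0.
apply: (@le_trans _ _ (lebesgue_rV R n (ball x (2 * diam K)))); last first.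
  rewrite [leLHS]lebesgue_rV_ball// lee_fin le_eqVlt; apply/orP; left; apply/eqP.
  by congr (_ ^+ _); lra.
apply: le_measure; rewrite ?inE.
- by apply: open_measurable_rV; exact: open_interior.
- exact: measurable_ball_rV.
move=> y /interior_subset Ky; rewrite -ball_normE/=.
apply: (@le_lt_trans _ _ (diam K)); last by lra.
apply: le_trans (le_norm_enorm _) _; exact: enorm_le_diam.
Qed.

Lemma sum_diam_bound n (S : seq (set 'rV[R]_n)) (sigma B : R) : (0 < n)%N ->
  0 < sigma -> 0 < B -> uniq S ->
  (forall K, K \in S -> polytope K /\ K° !=set0) ->
  (forall K, K \in S -> diam K / inscribed_diam K < sigma) ->
  (forall K, K \in S -> forall x, K x -> `|x| <= B) ->
  (forall K K', K \in S -> K' \in S -> K != K' -> K° `&` K'° = set0) ->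
  \sum_(K <- S) diam K ^+ n <= ((B + 1) / (2 * sigma * n%:R)^-1) ^+ n.
Proof.
move=> n0 s0 B0 uS pS rS bS dS; set th := (2 * sigma * n%:R)^-1.
have th0 : 0 < th by rewrite invr_gt0 !mulr_gt0// ltr0n.
have B1 : 0 < B + 1 by rewrite addr_gt0.
have H : (\sum_(K <- S) \int[lebesgue_rV R n]_(x in K°) 1 <=
    \int[lebesgue_rV R n]_(x in ball (0%R : 'rV[R]_n) (B + 1)%R) 1)%E.
  apply: (sum_integral_disjoint uS) => //.
  - exact: measurable_ball_rV.
  - by move=> K; apply: open_measurable_rV; exact: open_interior.
  - move=> K KS x /interior_subset Kx; rewrite -ball_normE/= sub0r normrN.
    by rewrite (le_lt_trans (bS K KS x Kx))// ltrDl.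
rewrite integral_cst// ?mul1e in H; last exact: measurable_ball_rV.
rewrite [leRHS]lebesgue_rV_ball// in H.
have th2 : 0 < (th *+ 2) ^+ n by rewrite exprn_gt0// mulrn_wgt0.
rewrite -(ler_pM2l th2).
have -> : (th *+ 2) ^+ n * ((B + 1) / th) ^+ n = ((B + 1) *+ 2) ^+ n.
  by rewrite -exprMn; congr (_ ^+ _); field; rewrite gt_eqF.
rewrite -lee_fin; apply: le_trans H.
rewrite mulr_sumr -sumEFin big_seq [leRHS]big_seq; apply: lee_sum => K KS.
have [pK K0] := pS K KS.
have [h0 _] := element_center n0 pK K0 s0 (rS K KS).
have [x Kx] := K0.
have [z zK _] := element_cube n0 pK K0 s0 (rS K KS) (interior_subset Kx) h0 (lexx _).
have mKi : measurable (K° : set 'rV[R]_n) by apply: open_measurable_rV; exact: open_interior.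
rewrite integral_cst// mul1e.
apply: (@le_trans _ _ (lebesgue_rV R n (ball z (th * diam K)))).
  rewrite [leRHS]lebesgue_rV_ball ?mulr_gt0// lee_fin -exprMn.
  by rewrite mulrnAl.
apply: le_measure; rewrite ?inE//; first exact: measurable_ball_rV.
by rewrite -open_subsetE//; exact: ball_open.
Qed.

Lemma diam_ge0 n (K : set 'rV[R]_n) : 0 <= diam K.
Proof.
rewrite /diam; have [h|/sup_out ->//] := pselect (has_sup [set enorm (x - y) | x in K & y in K]).
have [[z Kz] ubK] := h; apply: le_trans (ub_le_sup ubK Kz).
by case: Kz => x _ [y _ <-]; exact: sqrtr_ge0.
Qed.

Lemma diam_le n (K : set 'rV[R]_n) (B : R) : (0 < n)%N -> polytope K -> K !=set0 ->
  (forall x, K x -> `|x| <= B) -> diam K <= n%:R * (B + B).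
Proof.
move=> n0 pK [x Kx] bK; apply: ge_sup.
  by exists (enorm (x - x)); exists x => //; exists x.
move=> _ [y Ky [z Kz <-]]; apply: le_trans (le_enorm_norm _ n0) _.
rewrite ler_wpM2l//; apply: le_trans (ler_normB _ _) _; by rewrite lerD ?bK.
Qed.

Lemma approximation_lower_bound (n r : nat) (Omega G : set 'rV[R]_n)
    (p delta : R) (u : 'rV[R]_n -> R)
    (I : Type) (T : I -> seq (set 'rV[R]_n)) (V : I -> set ('rV[R]_n -> R))
    (gam : 'I_n -> nat) (j : nat) (q : \bar R) :
  (1 <= n)%N -> bounded_set Omega -> open G -> G `<=` Omega ->
  1 <= p -> 0 < delta ->
  in_frac_sobolev (r%:R + delta) p G u ->
  (forall i, is_mesh Omega (T i)) ->
  (forall i, fe_space r (T i) (V i)) ->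
  midx_order gam = r -> (0 < Lp_norm G p%:E (weakD G gam u))%E ->
  (forall i v, V i v -> elementwise_derivative_zero (T i) gam v) ->
  regular_family T -> (j <= r)%N -> (1 <= q)%E ->
  exists C6 h0 : R, [/\ 0 < C6, 0 < h0
      & forall i, resolves (T i) G \/ mesh_size (T i) < h0 ->
        (C6%:E <= approximation_error p
                    (p * ((j%:R - r%:R) + n%:R * (p^-1 - fine (q^-1)%E)))
                    j q G (T i) (V i) u)%E].
Proof.
move=> n0 bO oG GO p1 delta0 [uW _] mesh fe gr gp gv [sigma s0 reg] jr q1.
have p0 : 0 < p by exact: lt_le_trans p1.
have rt : (r <= Num.truncn (r%:R + delta))%N.
  have rd : 0 <= r%:R + delta by rewrite addr_ge0// ltW.
  by rewrite truncn_ge_nat// lerDl ltW.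
have wu a : (midx_order a <= r)%N -> exists ga, is_weak_derivative G a u ga.
  by move=> ar; have [] := uW a (leq_trans ar rt).
set g := weakD G gam u in gp.
have wg : is_weak_derivative G gam u g.
  have [ga wga] := wu gam (eq_leq gr).
  by apply: (@xgetPex _ (cst 0) [set g | is_weak_derivative G gam u g]); exists ga.
have [_ lg _] := wg.
pose theta := (2 * sigma * n%:R)^-1.
have theta0 : 0 < theta by rewrite invr_gt0 !mulr_gt0// ltr0n.
pose kap := (flat 0 4^-1 ^+ 2 * theta / (12 * (1 + theta))) ^+ n : R.
have kap0 : 0 < kap.
  apply: exprn_gt0; apply: divr_gt0; last by rewrite mulr_gt0// addr_gt0.
  by rewrite mulr_gt0// exprn_gt0// flat0_gt0.
have [Q [C [f [t [eta [eps0 [d [[cQ QG] [cC CG] [cf [t0 eta0 e0 d0]] fC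
    [CQ Cd core]]]]]]]]] := compact_core oG lg p0 gp theta0 kap0.
have jg : (j <= midx_order gam)%N by rewrite gr.
have [a [b [gamE aj bj]]] := midx_split jg.
have [M M1 bM] := @derive1n_bump_bounded_le R r.
have [B B0 HB] := bounded_closure bO.
pose Dm := n%:R * (B + B).
have Dm0 : 0 < Dm by rewrite mulr_gt0 ?ltr0n// addr_gt0.
(* As [diam K <= Dm], [rho * diam K <= min (diam K) eta], the size of the cubes. *)
pose rho := Num.min 1 (eta / Dm).
have rho0 : 0 < rho by rewrite lt_min ltr01 divr_gt0.
pose A0 := (theta * rho)^-1 ^+ midx_order b * M ^+ n.
have A00 : 0 < A0.
  by rewrite mulr_gt0// exprn_gt0// ?invr_gt0 ?mulr_gt0// (lt_le_trans _ M1).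
pose c1 := A0 * ((4 ^+ n) `^ (1 - fine (q^-1)%E)).
have c10 : 0 < c1 by rewrite mulr_gt0// powR_gt0// exprn_gt0.
pose Mh := ((B + 1) / theta) ^+ n.
have Mh0 : 0 < Mh by rewrite exprn_gt0// divr_gt0// addr_gt0.
pose S0 := (eps0 / (2 * c1)) * (eps0 / (2 * c1 * Mh)) `^ (p - 1).
have S00 : 0 < S0.
  have d1 : 0 < eps0 / (2 * c1) by rewrite divr_gt0// mulr_gt0.
  have d2 : 0 < eps0 / (2 * c1 * Mh) by rewrite divr_gt0// mulr_gt0// mulr_gt0.
  by rewrite mulr_gt0// powR_gt0.
exists (S0 `^ p^-1), d; split => //; first by rewrite powR_gt0.
move=> i iT.
set e := p * _.
apply: le_ereal_inf_tmp => _ [v Vv <-].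
set S := submesh (T i) G.
have mi := mesh i.
have uS : uniq S by apply: filter_uniq; exact: mesh_uniq mi.
have ST K : K \in S -> K \in T i /\ K° `<=` G.
  by rewrite mem_filter => /andP[/asboolP].
have pS K : K \in S -> polytope K /\ K° !=set0.
  by move=> /ST[KT _]; exact: (mesh_polytope mi KT).
have rS K : K \in S -> diam K / inscribed_diam K < sigma.
  by move=> /ST[KT _]; exact: reg KT.
have hS K : K \in S -> 0 < diam K.
  by move=> KS; have [pK K0] := pS K KS; have [] := element_center n0 pK K0 s0 (rS K KS).
have bS K : K \in S -> forall x, K x -> `|x| <= B.
  move=> /ST[KT _] x Kx; apply: HB; rewrite (mesh_cover mi); by exists K.
have dS K K' : K \in S -> K' \in S -> K != K' -> K° `&` K'° = set0.
  by move=> /ST[KT _] /ST[KT' _] /eqP; exact: (mesh_disjoint mi).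
have covC : C `<=` \bigcup_(K in [set` S]) K.
  move=> x Cx; case: iT => [res|small]; first exact/res/CG.
  have : closure Omega x by apply: subset_closure; exact/GO/CG.
  rewrite (mesh_cover mi) => -[K /= KT Kx]; exists K => //=.
  rewrite mem_filter KT andbT; apply/asboolP => y /interior_subset Ky.
  have [pK _] := mesh_polytope mi KT.
  apply: (Cd x) => //; apply: le_lt_trans (le_norm_enorm _) _.
  apply: le_lt_trans (enorm_le_diam pK Kx Ky) _; apply: le_lt_trans small.
  exact: le_bigmax_seq.
pose w K := weakD K° a (u \- v).
pose W K := (\int[lebesgue_rV R n]_(x in K°) `|w K x|%:E)%E.
pose N K := sobolev_norm j q K° (u \- v).
pose X K := ((diam K `^ e)%:E * N K `^ p)%E.
have mint (K : set 'rV[R]_n) : measurable K°.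
  by apply: open_measurable_rV; exact: open_interior.
have mQ := compact_measurable_rV cQ.
have W0 K : (0 <= W K)%E by exact: integral_ge0.
have N0 K : (0 <= N K)%E.
  rewrite /N /sobolev_norm; case: (q) => [s| |]; first exact: poweR_ge0.
    by apply: bigmax_ge_id.
  by apply: bigmax_ge_id.
have X0 K : (0 <= X K)%E by rewrite mule_ge0 ?lee_fin ?powR_ge0 ?poweR_ge0.
have vP K : K \in S -> exists2 P, polynomial_lt r P & forall x, K° x -> v x = P x.
  by move=> /ST[KT _]; have [_ _ /(_ v Vv)] := fe i; exact.
have br : (midx_order b <= r)%N by rewrite bj gr leq_subr.
have ar : (midx_order a <= r)%N by rewrite aj.
have local K : K \in S ->
    ((t / 2 * kap)%:E * lebesgue_rV R n (C `&` K) <=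
     \int[lebesgue_rV R n]_(x in K° `&` Q) `|g x - f x|%:E +
     (A0 * (diam K)^-1 ^+ (r - j))%:E * W K)%E.
  move=> KS; have [KT KG] := ST K KS; have [pK K0] := pS K KS; have h0 := hS K KS.
  have v0 x : K° x -> mpartial gam v x = 0 by exact: (gv i v Vv K KT).
  have := element_bound n0 s0 pK K0 (rS K KS) oG KG cQ cC cf t0 eta0 fC CQ
    (wu a ar) wg (vP K KS) v0 gamE br M1 bM.
  move=> /le_trans; apply; rewrite leeD2l// lee_wpmul2r//; first exact: W0.
  rewrite lee_fin -/theta bj gr /A0 bj gr mulrAC -exprMn.
  rewrite ler_wpM2r ?exprn_ge0// ?(le_trans _ M1)//.
  have lr : rho * diam K <= Num.min (diam K) eta.
    rewrite le_min; apply/andP; split.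
      by rewrite ler_piMl ?(ltW h0)// /rho ge_min lexx.
    apply: (@le_trans _ _ (eta / Dm * diam K)).
      by rewrite ler_wpM2r ?(ltW h0)// /rho ge_min lexx orbT.
    rewrite mulrAC ler_pdivrMr// ler_pM2l//.
    by apply: (diam_le n0 pK) (bS K KS); have [x Kx] := K0; exists x; exact: interior_subset.
  have l0 : 0 < Num.min (diam K) eta by rewrite lt_min h0.
  have th1 : 0 <= (theta * rho)^-1 / diam K.
    by rewrite divr_ge0 ?invr_ge0 ?mulr_ge0// ltW.
  apply: lerXn2r => //; first by rewrite nnegrE invr_ge0 mulr_ge0// ltW.
  rewrite -invfM lef_pV2 ?posrE ?mulr_gt0// -mulrA ler_pM2l//.
have total : (eps0%:E <= \sum_(K <- S) (A0 * (diam K)^-1 ^+ (r - j))%:E * W K)%E.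
  have mC := compact_measurable_rV cC.
  have c0 : (0 <= (t / 2 * kap)%:E)%E by rewrite lee_fin mulr_ge0 ?divr_ge0// ltW.
  set IQ := (\int[_]_(x in Q) _)%E in core.
  have IQfin : IQ \is a fin_num.
    rewrite ge0_fin_numE; last exact: integral_ge0.
    apply: le_lt_trans (_ : IQ + eps0%:E < +oo)%E.
      by rewrite leeDl// lee_fin ltW.
    by apply: le_lt_trans core _; rewrite lte_mul_pinfty//; exact: lebesgue_rV_compact.
  rewrite -(leeD2lE _ _ IQfin); apply: le_trans core _.
  have mS K : K \in S -> measurable K.
    by move=> /pS[pK _]; apply: compact_measurable_rV; exact: polytope_compact.
  apply: le_trans (lee_wpmul2l c0 (le_measure_bigcup mC mS covC)) _.
  rewrite ge0_sume_distrr//.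
  apply: (@le_trans _ _ (\sum_(K <- S) (\int[lebesgue_rV R n]_(x in K° `&` Q) `|g x - f x|%:E +
     (A0 * (diam K)^-1 ^+ (r - j))%:E * W K))%E).
    by rewrite big_seq [leRHS]big_seq; apply: lee_sum => K KS; exact: local.
  rewrite big_split/= leeD2r//.
  apply: (sum_integral_disjoint uS) => //.
  - by move=> K; exact: measurableI.
  - move=> K K' KS KS' KK'; rewrite setIACA dS// set0I//.
  - apply/measurable_EFinP; apply: measurableT_comp => //; apply: measurable_funB.
      by have [mg _] := lg; apply: measurable_funS mg => //; exact: open_measurable_rV.
    by apply: measurable_funTS; exact: continuous_measurable_rV.
have sumh : \sum_(K <- S) diam K ^+ n <= Mh by exact: (sum_diam_bound n0 s0 B0 uS pS rS bS dS).
have weighted tau : 0 < tau ->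
    (eps0%:E <= c1%:E * ((tau * Mh)%:E + (tau `^ (1 - p))%:E * \sum_(K <- S) X K))%E.
  move=> tau0; apply: le_trans total _.
  apply: (@le_trans _ _ (\sum_(K <- S) (c1%:E * ((tau * diam K ^+ n)%:E +
      (tau `^ (1 - p))%:E * X K)))%E).
    rewrite big_seq [leRHS]big_seq; apply: lee_sum => K KS.
    have [KT KG] := ST K KS; have [pK K0] := pS K KS.
    have oK : open K° by exact: open_interior.
    have v0 x : K° x -> mpartial gam v x = 0 by exact: (gv i v Vv K KT).
    have [wK _] := weakD_error_moment oG oK KG (wu a ar) wg (vP K KS) v0 gamE.
    apply: (element_weight p1 (hS K KS) tau0 (ltW A00) jr q1 (N0 K) (W0 K)).
    have V0 : 0 <= (4 * diam K) ^+ n by rewrite exprn_ge0// mulr_ge0// ltW// hS.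
    have mw : measurable_fun K° (w K) by have [_ []] := wK.
    apply: le_trans (hoelder_set (mint K) V0 (lebesgue_rV_element pK K0 (hS K KS))
      (lebesgue_rV_gt0 n) mw q1) _.
    rewrite lee_wpmul2l ?lee_fin ?powR_ge0//.
    by apply: Lp_norm_le_sobolev_norm => //; rewrite aj.
  have ge0 K : (0 <= (tau * diam K ^+ n)%:E + (tau `^ (1 - p))%:E * X K)%E.
    apply: adde_ge0; last by apply: mule_ge0; [rewrite lee_fin powR_ge0|exact: X0].
    rewrite lee_fin; apply: mulr_ge0; first exact: ltW.
    by apply: exprn_ge0; exact: diam_ge0.
  rewrite -ge0_sume_distrr//.
  rewrite lee_wpmul2l ?lee_fin ?(ltW c10)//.
  rewrite big_split/= -ge0_sume_distrr//; apply: leeD => //.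
  by rewrite sumEFin lee_fin -mulr_sumr ler_wpM2l// ltW.
have XE : (\sum_(K <- S) (diam K `^ e)%:E * sobolev_norm j q K° (u \- v)%R `^ p =
  \sum_(K <- S) X K)%E by [].
rewrite XE.
have sX0 : (0 <= \sum_(K <- S) X K)%E by apply: sume_ge0.
case: (\sum_(K <- S) X K)%E sX0 weighted => [s| |] // sX0 weighted; last first.
  by rewrite poweRyr ?leey// invr_neq0// gt_eqF.
rewrite lee_fin in sX0.
rewrite poweR_EFin lee_fin.
have sS : S0 <= s.
  apply: (error_lower_bound p1 e0 c10 Mh0) => tau tau0.
  by have := weighted tau tau0; rewrite -!EFinM lee_fin.
by apply: ge0_ler_powR; rewrite ?nnegrE ?invr_ge0// ltW.
Qed.

End assembly.

Theorem theorem2p2 (R : realType) (n r : nat) (Omega G : set 'rV[R]_n)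
    (p delta : R) (u : 'rV[R]_n -> R)
    (I : Type) (T : I -> seq (set 'rV[R]_n)) (V : I -> set ('rV[R]_n -> R)) :
  (1 <= n)%N -> (1 <= r)%N ->
  polytopic_lipschitz_domain Omega ->
  is_domain G -> G `<=` Omega ->
  1 <= p -> 0 < delta ->
  in_frac_sobolev (r%:R + delta) p G u ->
  (forall i, is_mesh Omega (T i)) ->
  (forall i, fe_space r (T i) (V i)) ->
  (exists gamma : 'I_n -> nat,
    [/\ midx_order gamma = r,
        (0 < Lp_norm G p%:E (weakD G gamma u))%E
      & forall i v, V i v -> elementwise_derivative_zero (T i) gamma v]) ->
  regular_family T ->
  (forall j : nat, (j <= r)%N ->
    exists C5 h0 : R, [/\ 0 < C5, 0 < h0
      & forall i, resolves (T i) G \/ mesh_size (T i) < h0 ->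
        (C5%:E <= approximation_error p (p * (j%:R - r%:R)) j p%:E
                    G (T i) (V i) u)%E])
  /\
  (forall (j : nat) (q : \bar R), (j <= r)%N -> (1 <= q)%E ->
    sobolev_embeds (r%:R + delta) p j q G ->
    exists C6 h0 : R, [/\ 0 < C6, 0 < h0
      & forall i, resolves (T i) G \/ mesh_size (T i) < h0 ->
        (C6%:E <= approximation_error p
                    (p * ((j%:R - r%:R) + n%:R * (p^-1 - fine (q^-1)%E)))
                    j q G (T i) (V i) u)%E]).
Proof.
move=> n1 r1 [_ bO _ _] [oG _ _] GO p1 delta0 uW mesh fe [gam [gr gp gv]] reg.
have bound j q : (j <= r)%N -> (1 <= q)%E -> _ :=
  @approximation_lower_bound R n r Omega G p delta u I T V gam j q
    n1 bO oG GO p1 delta0 uW mesh fe gr gp gv reg.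
split=> [j jr|j q jr q1 _]; last exact: bound.
have := bound j p%:E jr; rewrite lee_fin => /(_ p1).
have p0 : 0 < p by exact: lt_le_trans p1.
by rewrite inver (gt_eqF p0)/= subrr mulr0 addr0.
Qed.
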